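(* The following statements are equivalent for a group $G$. (i) The group $G$ is residually finite and lies in the class $\mathcal{A}_2$. (ii) For any group extension $1\to N\to E\to G\to 1$ with $N$ finitely generated and residually finite, $E$ is residually finite. (iii) For any group extension $1\to F\to E\to G\to 1$ with $F$ finite, $E$ is residually finite.
   Context: For a group $G$, let $\hat{G}$ be its profinite completion and $c_G:G\to\hat{G}$ the completion map. For a nonnegative integer $n$, $\mathcal{A}_n$ is the class of all groups $G$ such that, for every finite discrete $\hat{G}$-module $A$, the map $H^i_c(\hat{G},A)\to H^i(G,A)$ induced by $c_G$, from continuous to ordinary (discrete) group cohomology, is bijective for $0\leq i\leq n$ and injective for $i=n+1$ (equivalently, surjective for $0\le i\le n$). *)

(* Defs.v *)
From HB Require Import structures.
From mathcomp Require Import all_boot all_order all_algebra.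
From mathcomp Require Import all_classical topology.

Set Implicit Arguments.
Unset Strict Implicit.
Unset Printing Implicit Defensive.

Local Open Scope classical_set_scope.
Local Open Scope quotient_scope.

Record normal_subgroup (G : groupType) := NormalSubgroup {
  nsub :> {pred G};
  nsub_closed : group_closed nsub;
  nsub_conj : forall x y : G, x \in nsub -> (x ^ y)%g \in nsub }.

Section QuotientGroup.
Local Open Scope group_scope.
Variables (G : groupType) (N : normal_subgroup G).

Definition coset_rel (x y : G) : bool := x^-1 * y \in N.

Lemma nsub1 : 1 \in N.
Proof. by case: (nsub_closed N). Qed.

Lemma nsubM x y : x \in N -> y \in N -> x * y \in N.
Proof. exact: (group_closedM (nsub_closed N)). Qed.

Lemma nsubV x : x \in N -> x^-1 \in N.
Proof. exact: (group_closedV (nsub_closed N)). Qed.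

Lemma coset_rel_equiv : equiv_class_of coset_rel.
Proof.
split=> [x|x y|y x z]; rewrite /coset_rel.
- by rewrite mulVg nsub1.
- by apply/idP/idP => /nsubV; rewrite invgM invgK.
- by move=> xy yz; have := nsubM xy yz; rewrite mulgA mulgK.
Qed.

Canonical coset_equiv := EquivRelPack coset_rel_equiv.
Canonical coset_encModRel := defaultEncModRel coset_rel.

Definition quotient_group := {eq_quot coset_rel}.

HB.instance Definition _ : EqQuotient G coset_rel quotient_group :=
  EqQuotient.on quotient_group.
HB.instance Definition _ := Choice.on quotient_group.

Definition qone : quotient_group := lift_cst quotient_group 1.
Definition qmul := lift_op2 quotient_group ( *%g : G -> G -> G).
Definition qinv := lift_op1 quotient_group (fun x : G => x^-1).

Canonical pi_qone_morph := PiConst qone.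

Lemma pi_qinv : {morph \pi : x / x^-1 >-> qinv x}.
Proof.
move=> x; unlock qinv; apply/eqP; rewrite piE /coset_rel invgK.
have : x == repr (\pi_quotient_group x) %[mod quotient_group] by rewrite reprK.
rewrite piE /coset_rel => /nsubV Nx; have := @nsub_conj _ N _ x^-1 Nx.
by rewrite /conjg invgM !invgK mulgK.
Qed.
Canonical pi_qinv_morph := PiMorph1 pi_qinv.

Lemma pi_qmul : {morph \pi : x y / x * y >-> qmul x y}.
Proof.
move=> x y; unlock qmul; apply/eqP; rewrite piE /coset_rel.
set x' := repr (\pi x); set y' := repr (\pi y).
have : x == x' %[mod quotient_group] by rewrite reprK.
have : y == y' %[mod quotient_group] by rewrite reprK.
rewrite !piE /coset_rel => Ny Nx.
have := nsubM (@nsub_conj _ N _ y Nx) Ny; rewrite /conjg invgM.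
by rewrite !mulgA mulgK.
Qed.
Canonical pi_qmul_morph := PiMorph2 pi_qmul.

Lemma qmulA : associative qmul.
Proof.
by move=> x y z; rewrite -[x]reprK -[y]reprK -[z]reprK !piE mulgA.
Qed.

Lemma q1mul : left_id qone qmul.
Proof. by move=> x; rewrite -[x]reprK !piE mul1g. Qed.

Lemma qmul1 : right_id qone qmul.
Proof. by move=> x; rewrite -[x]reprK !piE mulg1. Qed.

Lemma qmulV : left_inverse qone qinv qmul.
Proof. by move=> x; rewrite -[x]reprK !piE mulVg. Qed.

Lemma qmulVr : right_inverse qone qinv qmul.
Proof. by move=> x; rewrite -[x]reprK !piE mulgV. Qed.

HB.instance Definition _ :=
  isGroup.Build quotient_group qmulA q1mul qmul1 qmulV qmulVr.

Lemma pi_quotient_group_morphism : monoid_morphism (\pi_quotient_group).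
Proof. by split=> [|x y]; [rewrite -[RHS]/qone piE | exact: pi_qmul]. Qed.

End QuotientGroup.

Section QuotientProjection.
Local Open Scope group_scope.
Variables (G : groupType) (M N : normal_subgroup G).

(* The projection [G / M -> G / N], meaningful when [M] is contained in [N]. *)
Definition quotient_proj (a : quotient_group M) : quotient_group N :=
  \pi_(quotient_group N) (repr a).

Lemma quotient_proj_pi : {subset M <= N} -> forall x,
  quotient_proj (\pi_(quotient_group M) x) = \pi_(quotient_group N) x.
Proof.
move=> sMN x; apply/eqP; rewrite /quotient_proj piE; apply: sMN.
have : repr (\pi_(quotient_group M) x) == x %[mod quotient_group M].
  by rewrite reprK.
by rewrite piE.
Qed.

Lemma quotient_proj_morphism :
  {subset M <= N} -> monoid_morphism quotient_proj.
Proof.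
have [pi1 piM] := pi_quotient_group_morphism M.
have [pi1' piM'] := pi_quotient_group_morphism N.
move=> sMN; split=> [|a b]; first by rewrite -pi1 quotient_proj_pi.
by rewrite -[a]reprK -[b]reprK -piM !quotient_proj_pi.
Qed.

Lemma quotient_projV (a : quotient_group M) :
  {subset M <= N} -> quotient_proj a^-1 = (quotient_proj a)^-1.
Proof.
move=> /quotient_proj_morphism[p1 pM]; apply: (mulIg (quotient_proj a)).
by rewrite -pM !mulVg.
Qed.

End QuotientProjection.

Record finite_index_normal (G : groupType) := FiniteIndexNormal {
  fin_nsub :> normal_subgroup G;
  fin_index : finite_set [set: quotient_group fin_nsub] }.

Definition residually_finite (G : groupType) : Prop :=
  forall x : G, x <> 1%g -> exists N : finite_index_normal G, x \notin N.

Definition finitely_generated (G : groupType) : Prop :=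
  exists s : seq G, forall S : {pred G},
    group_closed S -> {subset s <= S} -> forall x, x \in S.

Record group_extension (N E G : groupType)
    (i : {multiplicative N -> E}) (p : {multiplicative E -> G}) : Prop :=
  GroupExtension {
  ext_injective : injective i;
  ext_surjective : forall g, exists e, p e = g;
  ext_exact : forall e, p e = 1%g <-> exists n, i n = e }.

HB.mixin Record Group_isTopological G of Group G & Topological G := {
  mulg_continuous : continuous (fun xy : G * G => (xy.1 * xy.2)%g);
  invg_continuous : continuous (fun x : G => x^-1%g) }.

#[short(type="topologicalGroupType")]
HB.structure Definition TopologicalGroup :=
  {G of Group_isTopological G & Group G & Topological G}.

Section ProfiniteCompletion.
Local Open Scope group_scope.
Variable G : groupType.
Implicit Types M N : finite_index_normal G.

(* The inverse limit of the discrete finite quotients [G / N], as a subspace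
   of their topological product. *)
Definition finite_quotients :=
  prod_topology (fun N : finite_index_normal G =>
    discrete_topology (quotient_group N)).

Definition compatible : set finite_quotients :=
  [set x | forall M N, {subset M <= N} -> quotient_proj N (x M) = x N].

Definition profinite_completion : Type := compatible.

HB.instance Definition _ := Topological.on profinite_completion.

Implicit Types x y z : profinite_completion.

Definition coordinate x N : quotient_group N := set_val x N.

Lemma profiniteP x y : (forall N, coordinate x N = coordinate y N) -> x = y.
Proof. by move=> xy; apply: val_inj; apply: functional_extensionality_dep. Qed.

Lemma profinite_subproof (u : forall N, quotient_group N) :
  (forall M N, {subset M <= N} -> quotient_proj N (u M) = u N) ->
  (u : finite_quotients) \in compatible.
Proof. by move=> uP; apply/mem_set. Qed.

Lemma coordinateP x M N :
  {subset M <= N} -> quotient_proj N (coordinate x M) = coordinate x N.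
Proof. exact: (set_mem (valP x)). Qed.

Definition profinite_mk (u : forall N, quotient_group N)
    (uP : forall M N, {subset M <= N} -> quotient_proj N (u M) = u N) :
  profinite_completion := exist _ (u : finite_quotients) (profinite_subproof uP).

Fact profinite_one_subproof M N : {subset M <= N} ->
  quotient_proj N (1 : quotient_group M) = 1.
Proof. by case/quotient_proj_morphism. Qed.

Fact profinite_mul_subproof x y M N : {subset M <= N} ->
  quotient_proj N (coordinate x M * coordinate y M) =
  coordinate x N * coordinate y N.
Proof.
by move=> sMN; have [_ ->] := quotient_proj_morphism sMN; rewrite !coordinateP.
Qed.

Fact profinite_inv_subproof x M N : {subset M <= N} ->
  quotient_proj N (coordinate x M)^-1 = (coordinate x N)^-1.
Proof. by move=> sMN; rewrite quotient_projV ?coordinateP. Qed.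

Definition profinite_one := profinite_mk profinite_one_subproof.
Definition profinite_mul x y := profinite_mk (profinite_mul_subproof x y).
Definition profinite_inv x := profinite_mk (profinite_inv_subproof x).

Fact profinite_mulA : associative profinite_mul.
Proof. by move=> x y z; apply: profiniteP => N; apply: mulgA. Qed.

Fact profinite_1mul : left_id profinite_one profinite_mul.
Proof. by move=> x; apply: profiniteP => N; apply: mul1g. Qed.

Fact profinite_mul1 : right_id profinite_one profinite_mul.
Proof. by move=> x; apply: profiniteP => N; apply: mulg1. Qed.

Fact profinite_mulV : left_inverse profinite_one profinite_inv profinite_mul.
Proof. by move=> x; apply: profiniteP => N; apply: mulVg. Qed.

Fact profinite_mulVr : right_inverse profinite_one profinite_inv profinite_mul.
Proof. by move=> x; apply: profiniteP => N; apply: mulgV. Qed.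

HB.instance Definition _ := isGroup.Build profinite_completion
  profinite_mulA profinite_1mul profinite_mul1 profinite_mulV profinite_mulVr.

Lemma coordinate_continuous N :
  continuous (fun x : profinite_completion =>
    coordinate x N : discrete_topology (quotient_group N)).
Proof.
move=> x; have vx : set_val @ x --> (set_val x : finite_quotients).
  exact: initial_continuous.
have /cvg_sup /(_ N) xN := vx.
have Fx : Filter (set_val @ x) by exact: (@fmap_filter _ _ _ (nbhs x)).
move=> A /(@initial_continuous _ _ (fun u : finite_quotients => u N) _).
exact: (xN Fx).
Qed.

Lemma profinite_cvg (F : set_system profinite_completion) x : Filter F ->
  (forall N, F [set y | coordinate y N = coordinate x N]) -> F --> x.
Proof.
move=> FF Fx A [_ [[B oB <-] Bx] sBA].
suff : set_val @ F --> (set_val x : finite_quotients).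
  move=> vF; have : (set_val @ F) B by apply: vF; apply: open_nbhs_nbhs.
  by move=> FB; apply: (filterS sBA FB).
apply/cvg_sup => N C [_ [[D oD <-] Dx] sDC].
suff: F (set_val @^-1` C) by [].
apply: (filterS _ (Fx N)) => y yx; apply: sDC.
have {}yx : coordinate y N = coordinate x N := yx.
by have : D (coordinate x N) := Dx; rewrite -yx.
Qed.

Fact profinite_mul_continuous :
  continuous (fun xy : profinite_completion * profinite_completion =>
    xy.1 * xy.2).
Proof.
move=> [x y]; apply: profinite_cvg => N.
have nx z : nbhs z [set z' | coordinate z' N = coordinate z N].
  exact: (coordinate_continuous (discrete_set1 _)).
exists ([set x' | coordinate x' N = coordinate x N],
        [set y' | coordinate y' N = coordinate y N]) => //=.
by move=> [x' y'] [/= xx' yy']; apply: (congr2 *%g xx' yy').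
Qed.

Fact profinite_inv_continuous :
  continuous (fun x : profinite_completion => x^-1).
Proof.
move=> x; apply: profinite_cvg; first exact: (@fmap_filter _ _ _ (nbhs x)).
move=> N; have : nbhs x [set z' | coordinate z' N = coordinate x N].
  exact: (coordinate_continuous (discrete_set1 _)).
by apply: filterS => z zx; apply: (congr1 (fun a => a^-1) zx).
Qed.

HB.instance Definition _ := Group_isTopological.Build profinite_completion
  profinite_mul_continuous profinite_inv_continuous.

(* The completion map [c_G]. *)
Definition completion_map (g : G) : profinite_completion :=
  profinite_mk (fun M N (sMN : {subset M <= N}) => quotient_proj_pi sMN g).

Fact completion_mapM : {morph completion_map : x y / x * y}.
Proof. by move=> x y; apply: profiniteP => N; apply: pi_qmul. Qed.

HB.instance Definition _ := isMultiplicative.Build G profinite_completion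
  completion_map completion_mapM.

End ProfiniteCompletion.

Import GRing.Theory.
Local Open Scope ring_scope.

Record gmodule (G : groupType) := GModule {
  gmod_carrier :> zmodType;
  gact : G -> gmod_carrier -> gmod_carrier;
  gact1 : forall a, gact 1%g a = a;
  gactM : forall x y a, gact (x * y)%g a = gact x (gact y a);
  gactB : forall x, {morph gact x : a b / a - b} }.

Definition cochain (G : groupType) (A : gmodule G) (n : nat) : Type :=
  ('I_n -> G) -> A.

HB.instance Definition _ G A n := GRing.Zmodule.on (@cochain G A n).

Section Differential.
Variables (G : groupType) (A : gmodule G) (n : nat).

(* The inhomogeneous bar complex, with arguments numbered from 0:
   [(g_0, ..., g_n)] becomes [(g_0, ..., g_j * g_(j+1), ..., g_n)]. *)
Definition contract (j : 'I_n) (g : 'I_n.+1 -> G) : 'I_n -> G := fun k =>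
  if (k < j)%N then g (lift ord_max k)
  else if k == j then (g (lift ord_max k) * g (lift ord0 k))%g
  else g (lift ord0 k).

Definition differential (f : cochain A n) : cochain A n.+1 := fun g =>
  gact (g ord0) (f (fun k => g (lift ord0 k)))
  + \sum_(j < n) f (contract j g) *~ (-1) ^+ j.+1
  + f (fun k => g (lift ord_max k)) *~ (-1) ^+ n.+1.

Lemma differential_is_zmod_morphism : zmod_morphism differential.
Proof.
move=> f h; apply: functional_extensionality_dep => g.
rewrite [LHS]/differential [RHS]/= /differential.
rewrite -[(_ - _) (fun k => g (lift ord0 k))]/(_ - _) gactB.
rewrite -[(_ - _) (fun k => g (lift ord_max k))]/(_ - _) mulrzBl.
rewrite (eq_bigr (fun j : 'I_n => f (contract j g) *~ (-1) ^+ j.+1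
    - h (contract j g) *~ (-1) ^+ j.+1)); last first.
  by move=> j _; rewrite -mulrzBl.
rewrite sumrB -[(_ - _) g]/(_ - _) !opprD.
by rewrite (addrACA (gact _ _)) (addrACA (gact _ _ + _)).
Qed.

HB.instance Definition _ := GRing.isZmodMorphism.Build
  (cochain A n) (cochain A n.+1) differential differential_is_zmod_morphism.

End Differential.

(* The cohomology of the subcomplex of admissible cochains given by [C]: all
   cochains for ordinary cohomology, continuous ones for continuous
   cohomology. *)
Section Cohomology.
Variables (G : groupType) (A : gmodule G).
Variable C : forall n, zmodClosed (cochain A n).

Definition is_cocycle n : {pred cochain A n} :=
  [pred f | (f \in C n) && (differential f == 0)].

Fact is_cocycle_zmod_closed n : zmod_closed (is_cocycle (n := n)).
Proof.
split=> [|f h]; rewrite !inE; first by rewrite rpred0 raddf0 eqxx.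
move=> /andP[Cf /eqP df] /andP[Ch /eqP dh].
by rewrite rpredB //= raddfB /= df dh subrr eqxx.
Qed.

HB.instance Definition _ n := GRing.isZmodClosed.Build (cochain A n)
  (is_cocycle (n := n)) (is_cocycle_zmod_closed n).

Record cocycle n := Cocycle {
  cocycle_val :> cochain A n;
  cocycleP : cocycle_val \in is_cocycle (n := n) }.

HB.instance Definition _ n := [isSub for @cocycle_val n].
HB.instance Definition _ n := [Choice of cocycle n by <:].
HB.instance Definition _ n := [SubChoice_isSubZmodule of cocycle n by <:].

Lemma cocycle_val_is_zmod_morphism n : zmod_morphism (@cocycle_val n).
Proof. exact: (raddfB (val : cocycle n -> cochain A n)). Qed.

HB.instance Definition _ n := GRing.isZmodMorphism.Build
  (cocycle n) (cochain A n) (@cocycle_val n) (@cocycle_val_is_zmod_morphism n).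

Definition coboundaries n : set (cochain A n) :=
  match n with
  | 0 => [set 0]
  | m.+1 => [set differential h | h in [set h : cochain A m | h \in C m]]
  end.

Definition is_coboundary n : {pred cocycle n} :=
  [pred f : cocycle n | `[< coboundaries (f : cochain A n) >]].

Fact is_coboundary_zmod_closed n : zmod_closed (is_coboundary (n := n)).
Proof.
split=> [|f h]; rewrite !inE ?raddf0 ?raddfB.
  case: n => [//|n]; exists (0 : cochain A n); first exact: rpred0.
  by rewrite raddf0.
case: n f h => [|n] f h /=; first by move=> -> ->; rewrite subr0.
move=> [f' Cf <-] [h' Ch <-]; exists (f' - h'); last by rewrite raddfB.
exact: rpredB.
Qed.

HB.instance Definition _ n := GRing.isZmodClosed.Build (cocycle n)
  (is_coboundary (n := n)) (is_coboundary_zmod_closed n).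

Definition cohomology n : zmodType := {ideal_quot @is_coboundary n}.

End Cohomology.

(* The action map is jointly continuous for the discrete topology. *)
Record finite_discrete_module (G : topologicalGroupType) :=
  FiniteDiscreteModule {
    fdm_module :> gmodule G;
    fdm_finite : finite_set [set: fdm_module];
    fdm_continuous : continuous
      (fun xa : G * discrete_topology fdm_module =>
         gact xa.1 xa.2 : discrete_topology fdm_module) }.

Definition all_cochains (G : groupType) (A : gmodule G) n :
  {pred cochain A n} := predT.

Fact all_cochains_zmod_closed (G : groupType) (A : gmodule G) n :
  zmod_closed (@all_cochains G A n).
Proof. by []. Qed.

HB.instance Definition _ (G : groupType) (A : gmodule G) n :=
  GRing.isZmodClosed.Build (cochain A n) (@all_cochains G A n)
    (all_cochains_zmod_closed A n).

Definition continuous_cochains (G : topologicalGroupType) (A : gmodule G) n :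
  {pred cochain A n} :=
  [pred f | `[< continuous (f : {ptws 'I_n -> G} -> discrete_topology A) >]].

Fact continuous_cochains_zmod_closed
    (G : topologicalGroupType) (A : gmodule G) n :
  zmod_closed (@continuous_cochains G A n).
Proof.
split=> [|f h]; rewrite !inE; first exact: cst_continuous.
move=> cf ch g; apply/discrete_cvg; first exact: (@fmap_filter _ _ _ (nbhs g)).
have fg : nbhs (g : {ptws 'I_n -> G}) [set g' | f g' = f g].
  exact: (cf g _ (discrete_set1 (f g : discrete_topology A))).
have hg : nbhs (g : {ptws 'I_n -> G}) [set g' | h g' = h g].
  exact: (ch g _ (discrete_set1 (h g : discrete_topology A))).
suff: nbhs (g : {ptws 'I_n -> G}) [set g' | (f - h) g' = (f - h) g] by [].
apply: (@filterS2 _ _ (nbhs_filter (g : {ptws 'I_n -> G})) _ _ _ _ fg hg).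
move=> g' /= fg' hg'.
exact: (congr2 (fun a b : A => a - b) fg' hg').
Qed.

HB.instance Definition _ (G : topologicalGroupType) (A : gmodule G) n :=
  GRing.isZmodClosed.Build (cochain A n) (@continuous_cochains G A n)
    (continuous_cochains_zmod_closed A n).

Definition group_cohomology (G : groupType) (A : gmodule G) n : zmodType :=
  cohomology (fun n => @all_cochains G A n) n.

Definition continuous_cohomology
    (G : topologicalGroupType) (A : gmodule G) n : zmodType :=
  cohomology (fun n => @continuous_cochains G A n) n.

Section Comparison.
Variables (G : groupType) (A : gmodule (profinite_completion G)).

(* [A] as a [G]-module through [c_G]. *)
Fact restrict_act1 (a : A) : gact (completion_map (1%g : G)) a = a.
Proof.
have -> : completion_map (1%g : G) = 1%g.
  by apply: (mulgI (completion_map 1%g)); rewrite -completion_mapM !mulg1.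
exact: gact1.
Qed.

Fact restrict_actM (x y : G) (a : A) :
  gact (completion_map (x * y)%g) a =
  gact (completion_map x) (gact (completion_map y) a).
Proof. by rewrite completion_mapM gactM. Qed.

Definition restrict : gmodule G :=
  GModule restrict_act1 restrict_actM (fun x => gactB (completion_map x)).

Definition restrict_cochain n (f : cochain A n) : cochain restrict n :=
  fun g => f (fun k => completion_map (g k)).

Lemma restrict_cochain_is_zmod_morphism n :
  zmod_morphism (@restrict_cochain n).
Proof. by []. Qed.

HB.instance Definition _ n := GRing.isZmodMorphism.Build
  (cochain A n) (cochain restrict n) (@restrict_cochain n)
  (@restrict_cochain_is_zmod_morphism n).

Lemma restrict_differential n (f : cochain A n) :
  differential (restrict_cochain f) = restrict_cochain (differential f).
Proof.
apply: functional_extensionality_dep => g.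
rewrite /restrict_cochain /differential /=; congr (_ + _ + _).
apply: eq_bigr => j _; congr (f _ *~ _).
apply: functional_extensionality_dep => k; rewrite /contract.
by case: ifP => // _; case: ifP => // _; rewrite completion_mapM.
Qed.

Notation Zc n := (cocycle (fun n => @continuous_cochains _ A n) n).
Notation Z n := (cocycle (fun n => @all_cochains G restrict n) n).

Fact restrict_cocycle_subproof n (f : Zc n) :
  restrict_cochain f \in is_cocycle (fun n => @all_cochains G restrict n) (n := n).
Proof.
have := cocycleP f; rewrite !inE /= => /andP[_ /eqP df].
by rewrite restrict_differential df raddf0.
Qed.

Definition restrict_cocycle n (f : Zc n) : Z n :=
  Cocycle (restrict_cocycle_subproof f).

(* The map induced on cohomology by [c_G]; [comparison_pi] shows that it does
   not depend on the choice of representatives. *)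
Definition comparison n (h : continuous_cohomology A n) :
    group_cohomology restrict n :=
  \pi_(group_cohomology restrict n) (restrict_cocycle (repr h)).

Lemma comparison_pi n (f : Zc n) :
  comparison (\pi_(continuous_cohomology A n) f) =
  \pi_(group_cohomology restrict n) (restrict_cocycle f).
Proof.
rewrite /comparison; set f' := repr _.
have : f' == f %[mod continuous_cohomology A n] by rewrite reprK.
rewrite -!Quotient.idealrBE !inE => Bf.
apply/eqP; rewrite -Quotient.idealrBE !inE.
clearbody f'; move: Bf; rewrite !raddfB.
case: n f f' => [|n] f f' /=.
  by move=> f'f; apply: (congr1 (@restrict_cochain 0) f'f).
move=> [h _ dh]; exists (restrict_cochain h); first by [].
by rewrite restrict_differential; apply: (congr1 (@restrict_cochain n.+1) dh).
Qed.

End Comparison.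

(* The class of groups written A_n. *)
Definition class_A (n : nat) (G : groupType) : Prop :=
  forall A : finite_discrete_module (profinite_completion G),
    (forall i, (i <= n)%N -> bijective (@comparison G A i)) /\
    injective (@comparison G A n.+1).

(* Main.v *)
(** Both implications are run through cochains. If [G] is residually finite and
    in [A_2], let [E -> G] be surjective with finite kernel [K]. Over the image
    [H] of the centralizer of [K] the extension is central, and Shapiro's lemma
    moves its class to a class of [G] in a coinduced module; this comes from a
    continuous cocycle, hence becomes trivial on some finite-index subgroup [U].
    The resulting splitting over [U] is a finite-index subgroup of [E] meeting
    [K] trivially. A finitely generated kernel is reduced to a finite one by
    dividing by a characteristic subgroup of finite index.

    Conversely, a 2-cocycle of [G] with finite coefficients [A] defines an
    extension [E] of [G] by [A]; a finite-index normal subgroup of [E] meeting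
    [A] trivially shows that the cocycle is cohomologous to one inflated from a
    finite quotient, so the comparison map is onto in degree 2. It is onto in
    degrees 0 and 1 for every [G], and injectivity in degree [n + 1] follows
    from bijectivity in degree [n] by dimension shifting. *)

From HB Require Import structures.
From mathcomp Require Import all_boot all_order all_algebra.
From mathcomp Require Import all_classical topology.
Require Import Defs.

Set Implicit Arguments.
Unset Strict Implicit.
Unset Printing Implicit Defensive.

Local Open Scope classical_set_scope.
Local Open Scope quotient_scope.

(** * Subgroups of finite index *)

(** Finiteness is handled throughout as an injective code into a [finType]: codes can be paired and
    tabulated, which settles products and function spaces without counting. *)
Lemma finite_codeP (T : eqType) (A : set T) :
  finite_set A <->
  exists (F : finType) (f : T -> F), forall x y, A x -> A y -> f x = f y ->
    x = y.
Proof.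
split=> [/finite_seqP[s ->] | [F [f f_inj]]].
  (* The successor keeps the code type inhabited when [s] is empty, as [inord] requires. *)
  exists 'I_(size s).+1, (fun x => inord (index x s)) => x y /= xs ys.
  move=> /(congr1 val); rewrite /= !inordK ?ltnS ?index_size //.
  exact: index_inj.
have /eq_finite_set <- : (f @` A #= A)%card; last exact: finite_finset.
by apply: inj_card_eq => x y /set_mem Ax /set_mem Ay; apply: f_inj.
Qed.

Lemma finite_typeP (T : eqType) :
  finite_set [set: T] <-> exists (F : finType) (f : T -> F), injective f.
Proof.
rewrite finite_codeP; split=> -[F [f f_inj]]; exists F, f => x y.
  exact: f_inj.
by move=> _ _; apply: f_inj.
Qed.

Lemma finite_functions (X Y : choiceType) :
  finite_set [set: X] -> finite_set [set: Y] -> finite_set [set: X -> Y].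
Proof.
move=> /finite_seqP[s sX] /finite_typeP[F [f f_inj]]; apply/finite_typeP.
have xs x : x \in s by rewrite -[is_true _]/([set` s] x) -sX.
exists {ffun seq_sub s -> F}, (fun u => [ffun x => f (u (ssval x))]).
move=> u v uv; apply: functional_extensionality_dep => x; apply: f_inj.
by have /ffunP/(_ (SeqSub (xs x))) := uv; rewrite !ffunE.
Qed.

Section FiniteIndex.
Local Open Scope group_scope.

Lemma group_pred_closed (G : groupType) (P : G -> Prop) :
  P 1 -> (forall x y, P x -> P y -> P (x * y)) -> (forall x, P x -> P x^-1) ->
  group_closed (fun x : G => `[< P x >]).
Proof.
move=> P1 PM PV; split; first exact/asboolP.
by move=> x y /asboolP Px /asboolP Py; apply/asboolP/PM => //; apply: PV.
Qed.

Lemma normal_subgroup_of (G : groupType) (P : G -> Prop) :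
  P 1 -> (forall x y, P x -> P y -> P (x * y)) -> (forall x, P x -> P x^-1) ->
  (forall x y, P x -> P (x ^ y)) ->
  exists N : normal_subgroup G, forall x, x \in N <-> P x.
Proof.
move=> P1 PM PV PJ.
have PJ' (x y : G) : x \in (fun x : G => `[< P x >]) ->
    x ^ y \in (fun x : G => `[< P x >]).
  by move=> /asboolP Px; apply/asboolP/PJ.
exists (NormalSubgroup (group_pred_closed P1 PM PV) PJ') => x.
by split=> [/asboolP|Px] //; apply/asboolP.
Qed.

Variable G : groupType.
Implicit Types (N : normal_subgroup G) (V : finite_index_normal G).

Lemma pi1 N : \pi_(quotient_group N) 1 = 1.
Proof. by case: (pi_quotient_group_morphism N). Qed.

Lemma piM N x y : \pi_(quotient_group N) (x * y) =
  \pi_(quotient_group N) x * \pi_(quotient_group N) y.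
Proof. by case: (pi_quotient_group_morphism N) => _; apply. Qed.

Lemma piP N x y : \pi_(quotient_group N) x = \pi_(quotient_group N) y <->
  x^-1 * y \in N.
Proof. by split=> [/eqP|xy]; [|apply/eqP]; rewrite piE. Qed.

Lemma pi_eq1 N x : \pi_(quotient_group N) x = 1 <-> x \in N.
Proof.
rewrite -(pi1 N); split=> [/esym/piP|xN]; first by rewrite invg1 mul1g.
by apply/esym/piP; rewrite invg1 mul1g.
Qed.

Lemma nsubJE N x y : (x ^ y \in N) = (x \in N).
Proof.
apply/idP/idP => [/(@nsub_conj _ N _ y^-1)|]; last exact: nsub_conj.
by rewrite -conjgM mulgV conjg1.
Qed.

Lemma nsub_mulC N x y : (x * y \in N) = (y * x \in N).
Proof. by rewrite -(nsubJE N _ x) /conjg mulgA mulKg. Qed.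

Lemma finite_indexP N :
  finite_set [set: quotient_group N] <->
  exists (F : finType) (f : G -> F), forall x y, f x = f y -> x^-1 * y \in N.
Proof.
rewrite finite_typeP; split=> -[F [f fP]].
  by exists F, (fun x => f (\pi x)) => x y /fP/piP.
exists F, (fun q => f (repr q)) => q q' /fP/piP.
by rewrite !reprK.
Qed.

Lemma finite_index_code V :
  exists (F : finType) (f : G -> F), forall x y, f x = f y -> x^-1 * y \in V.
Proof. exact/finite_indexP/fin_index. Qed.

Lemma fin_nsub_of (P : G -> Prop) :
  P 1 -> (forall x y, P x -> P y -> P (x * y)) -> (forall x, P x -> P x^-1) ->
  (forall x y, P x -> P (x ^ y)) ->
  (exists (F : finType) (f : G -> F), forall x y, f x = f y -> P (x^-1 * y)) ->
  exists V : finite_index_normal G, forall x, x \in V <-> P x.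
Proof.
move=> P1 PM PV PJ [F [f fP]].
have [N NP] := normal_subgroup_of P1 PM PV PJ.
have finN : finite_set [set: quotient_group N].
  by apply/finite_indexP; exists F, f => x y /fP/NP.
by exists (FiniteIndexNormal finN).
Qed.

Lemma fin_nsub_meet V V' : exists W : finite_index_normal G,
  forall x, x \in W <-> x \in V /\ x \in V'.
Proof.
have [[F [f fP]] [F' [f' fP']]] := (finite_index_code V, finite_index_code V').
apply: fin_nsub_of => [|x y [xV xV'] [yV yV']|x [xV xV']|x y [xV xV']|].
- by rewrite !nsub1.
- by rewrite !nsubM.
- by rewrite !nsubV.
- by rewrite !nsub_conj.
exists (F * F')%type, (fun x => (f x, f' x)) => x y [/fP xy /fP' xy'].
by split.
Qed.

Lemma fin_nsub_whole : exists V : finite_index_normal G, forall x, x \in V.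
Proof.
have [//|//|//|//||V VP] := @fin_nsub_of (fun=> True).
  by exists unit, (fun=> tt).
by exists V => x; apply/VP.
Qed.

Lemma fin_nsub_seq (I : eqType) (s : seq I) (V : I -> finite_index_normal G) :
  exists W : finite_index_normal G, forall i, i \in s -> {subset W <= V i}.
Proof.
elim: s => [|i s [W WP]]; first by have [W _] := fin_nsub_whole; exists W.
have [W' W'P] := fin_nsub_meet W (V i).
exists W' => j; rewrite inE => /orP[/eqP-> x /W'P[] //|js x /W'P[xW _]].
exact: WP xW.
Qed.

(** This is the normal core, the intersection of the conjugates of [D]. Its index is finite because
    [G] permutes finitely many left cosets of [D], and elements acting alike differ by an element of
    the core. *)
Lemma fin_nsub_core (D : {pred G}) (F : finType) (f : G -> F) :
  group_closed D -> (forall x y, f x = f y -> x^-1 * y \in D) ->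
  exists W : finite_index_normal G, forall x, x \in W <-> forall y, x ^ y \in D.
Proof.
move=> gD fP; have DM := group_closedM gD; have DV := group_closedV gD.
apply: fin_nsub_of => [y|x y xD yD z|x xD y|x y xD z|].
- by rewrite conj1g; case: gD.
- by rewrite conjMg DM.
- by rewrite conjVg DV.
- by rewrite -conjgM.
have rep t : exists e, (exists e', f e' = t) -> f e = t.
  by have [[e et]|nt] := pselect (exists e', f e' = t); [exists e|exists 1].
have [e eP] := choice rep.
(* The code of [x] tabulates the codes of [x * e t], where [e t] represents the fibre of [f] over
   [t]. *)
exists {ffun F -> F}, (fun x => [ffun t => f (x * e t)]) => x y fxy z.
have /ffunP/(_ (f z)) := fxy; rewrite !ffunE => /fP; rewrite invgM => Dxy.
have Dz : z^-1 * e (f z) \in D by apply/fP/esym/eP; exists z.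
have := DM _ _ (DM _ _ Dz Dxy) (DV _ Dz).
by rewrite invgM invgK /conjg !mulgA !mulgK.
Qed.

End FiniteIndex.

Section GroupMorphism.
Local Open Scope group_scope.
Variables (E G : groupType) (p : {multiplicative E -> G}).

Lemma morph1 : p 1 = 1.
Proof. by apply: (mulgI (p 1)); rewrite -gmulfM !mulg1. Qed.

Lemma morphV : {morph p : x / x^-1}.
Proof. by move=> x; apply: (mulgI (p x)); rewrite -gmulfM !mulgV morph1. Qed.

Lemma morphJ : {morph p : x y / x ^ y}.
Proof. by move=> x y; rewrite /conjg !gmulfM morphV. Qed.

End GroupMorphism.

Section Transfer.
Local Open Scope group_scope.
Variables (E G : groupType) (p : {multiplicative E -> G}).

Lemma fin_nsub_preim (V : finite_index_normal G) :
  exists W : finite_index_normal E, forall x, x \in W <-> p x \in V.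
Proof.
have [F [f fP]] := finite_index_code V.
apply: fin_nsub_of => [|x y|x|x y|].
- by rewrite morph1 nsub1.
- by rewrite gmulfM; apply: nsubM.
- by rewrite morphV; apply: nsubV.
- by rewrite morphJ; apply: nsub_conj.
by exists F, (f \o p) => x y /fP; rewrite gmulfM morphV.
Qed.

Hypothesis p_surj : forall g, exists e, p e = g.

Lemma fin_nsub_image (W : finite_index_normal E) :
  exists V : finite_index_normal G,
    forall g, g \in V <-> exists2 e, e \in W & p e = g.
Proof.
have [F [f fP]] := finite_index_code W; have [s sP] := choice p_surj.
apply: fin_nsub_of.
- by exists 1; rewrite ?nsub1 ?morph1.
- by move=> x y [e eW <-] [e' eW' <-]; exists (e * e'); rewrite ?nsubM ?gmulfM.
- by move=> x [e eW <-]; exists e^-1; rewrite ?nsubV ?morphV.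
- move=> x y [e eW <-]; exists (e ^ s y); first exact: nsub_conj.
  by rewrite morphJ sP.
exists F, (f \o s) => x y /fP xy; exists ((s x)^-1 * s y) => //.
by rewrite gmulfM morphV !sP.
Qed.

End Transfer.

Section FinitelyGenerated.
Local Open Scope group_scope.

(* The intersection of the kernels of all homomorphisms to a given finite group
   is characteristic, and has finite index since these homomorphisms are
   determined by their values at the generators. *)
Lemma fg_hom_kernel (N T : groupType) :
  finitely_generated N -> finite_set [set: T] ->
  exists W : finite_index_normal N, forall x, x \in W <->
    forall u : {multiplicative N -> T}, u x = 1.
Proof.
move=> [s sN] /finite_typeP[F [c c_inj]].
pose values (u : {multiplicative N -> T}) := [ffun i : seq_sub s =>
  c (u (ssval i))].
have values_inj u v : values u = values v -> forall x, u x = v x.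
  move=> uv x; suff: x \in (fun x : N => `[< u x = v x >]) by move=> /asboolP.
  apply: sN => [|y ys]; last first.
    apply/asboolP/c_inj; have /ffunP/(_ (SeqSub ys)) := uv.
    by rewrite !ffunE.
  apply: group_pred_closed => [|y z uy uz|y uy].
  - by rewrite !morph1.
  - by rewrite !gmulfM uy uz.
  - by rewrite !morphV uy.
(* Each table [t] of values gets a finite-index subgroup killed by the homomorphism with that table,
   or the whole group if there is none. The tables form a finite type, so these subgroups can be
   intersected. *)
have rep t : exists V : finite_index_normal N,
    (exists u, values u = t) -> exists2 u, values u = t &
    forall x, x \in V -> u x = 1.
  have [[u ut]|nt] := pselect (exists u, values u = t); last first.
    by have [V _] := fin_nsub_whole N; exists V => /nt.
  have [V VP] : exists V : finite_index_normal N, forall x, x \in V <-> u x = 1.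
    apply: fin_nsub_of.
    - exact: morph1.
    - by move=> x y ux uy; rewrite gmulfM ux uy mulg1.
    - by move=> x ux; rewrite morphV ux invg1.
    - by move=> x y ux; rewrite morphJ ux conj1g.
    exists F, (c \o u) => x y /c_inj uxy.
    by rewrite gmulfM morphV uxy mulVg.
  by exists V => _; exists u => // x /VP.
have [V VP] := choice rep.
have [W WP] := fin_nsub_seq (enum {ffun seq_sub s -> F}) V.
have [F' [f fP]] := finite_index_code W.
apply: fin_nsub_of.
- by move=> u; apply: morph1.
- by move=> x y ux uy u; rewrite gmulfM ux uy mulg1.
- by move=> x ux u; rewrite morphV ux invg1.
- by move=> x y ux u; rewrite morphJ ux conj1g.
exists F', f => x y /fP xyW u.
have [|v /values_inj vu vP] := VP (values u); first by exists u.
by rewrite -vu; apply/vP/(WP (values u)); rewrite ?mem_enum.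
Qed.

End FinitelyGenerated.

(** * Continuity on the profinite completion *)

Lemma ultra_finite_fiber (T : Type) (Y : eqType) (F : set_system T) (g : T ->
  Y) :
  UltraFilter F -> finite_set [set: Y] -> exists q, F [set x | g x = q].
Proof.
move=> FU /finite_seqP[s sY].
have : F [set x | g x \in s].
  by apply: filterS filterT => x _; have : [set: Y] (g x) by []; rewrite sY.
elim: s {sY} => [|a s IHs] Fs; first by have [] := filter_ex Fs.
have [Fa|Fa] := in_ultra_setVsetC [set x | g x = a] FU; first by exists a.
apply: IHs; apply: filterS (filterI Fs Fa) => x [/= + xa].
by rewrite inE => /orP[/eqP|].
Qed.

Section ProfiniteContinuity.
Variable G : groupType.
Notation K := (profinite_completion G).

Lemma nbhs_coordinate (n : nat) (z : 'I_n -> K) (V : finite_index_normal G) :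
  nbhs (z : {ptws 'I_n -> K})
    [set x | forall i, coordinate (x i) V = coordinate (z i) V].
Proof.
have nz i : nbhs (z : {ptws 'I_n -> K})
    [set x : 'I_n -> K | coordinate (x i) V = coordinate (z i) V].
  apply: (@proj_continuous _ (fun _ : 'I_n => K : topologicalType) i
    (z : {ptws 'I_n -> K}) [set y : K | coordinate y V = coordinate (z i) V]).
  exact: (coordinate_continuous (discrete_set1 _)).
exact: (filter_forall (nbhs_filter (z : {ptws 'I_n -> K})) nz).
Qed.

(** The congruence boxes around [z] generate a filter since finite-index subgroups can be
    intersected, so one [V] serves all coordinates; convergence to [z] is checked coordinatewise. *)
Lemma nbhs_coordinate_sub (n : nat) (z : 'I_n -> K) (B : set ('I_n -> K)) :
  nbhs (z : {ptws 'I_n -> K}) B ->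
  exists V : finite_index_normal G, forall x,
    (forall i, coordinate (x i) V = coordinate (z i) V) -> B x.
Proof.
pose F : set_system ('I_n -> K) := [set A | exists V : finite_index_normal G,
  forall x, (forall i, coordinate (x i) V = coordinate (z i) V) -> A x].
have Fmono (V W : finite_index_normal G) (x y : K) : {subset W <= V} ->
    coordinate x W = coordinate y W -> coordinate x V = coordinate y V.
  by move=> sWV xy; rewrite -!(coordinateP _ sWV) xy.
have FF : Filter F.
  split=> [|A A' [V VA] [V' VA']|A A' sAA' [V VA]].
  - by have [V _] := fin_nsub_whole G; exists V.
  - have [W WP] := fin_nsub_meet V V'.
    exists W => x xz; split; [apply: VA|apply: VA'] => i;
      by apply: Fmono (xz i) => y /WP[].
  - by exists V => x /VA/sAA'.
suff: F --> (z : {ptws 'I_n -> K}) by apply.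
apply/cvg_sup => i C [_ [[D oD <-] Dz] sDC].
suff /(_ D) : (fun x : 'I_n -> K => x i) @ F --> z i.
  case; first exact: open_nbhs_nbhs.
  by move=> V VD; exists V => x /VD Dx; apply: sDC.
by apply: profinite_cvg => V; exists V => x; apply.
Qed.

Lemma coordinate_sub (V W : finite_index_normal G) (x y : K) :
  {subset W <= V} -> coordinate x W = coordinate y W ->
  coordinate x V = coordinate y V.
Proof. by move=> sWV xy; rewrite -!(coordinateP _ sWV) xy. Qed.

(* Uniform continuity: a filter containing, for every [V], the points at which
   [f] is not constant modulo [V] would, by compactness, have a limit at which
   [f] is not locally constant. *)
Lemma continuous_cochainP (A : gmodule K) (n : nat) (f : cochain A n) :
  f \in @continuous_cochains K A n <->
  exists V : finite_index_normal G, forall x y,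
    (forall i, coordinate (x i) V = coordinate (y i) V) -> f x = f y.
Proof.
split=> [|[V fV]]; rewrite inE; last first.
  move=> z B Bz; have {}Bz : B (f z) := nbhs_singleton Bz.
  suff: nbhs (z : {ptws 'I_n -> K}) [set x | B (f x)] by [].
  apply: (@filterS _ _ (nbhs_filter (z : {ptws 'I_n -> K})) _ _ _
    (nbhs_coordinate z V)).
  by move=> x /fV /= ->.
move=> cf; apply: contrapT => nV.
pose bad (V : finite_index_normal G) := [set x : 'I_n -> K | exists2 y,
  (forall i, coordinate (x i) V = coordinate (y i) V) & f x <> f y].
have bad_ex V : bad V !=set0.
  apply: contrapT => noV; apply: nV; exists V => x y xy.
  by apply: contrapT => fxy; apply: noV; exists x, y.
have bad_sub (V W : finite_index_normal G) : {subset W <= V} ->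
  bad W `<=` bad V.
  move=> sWV x [y xy fxy]; exists y => // i.
  exact: coordinate_sub (xy i).
pose F0 : set_system ('I_n -> K) := [set S | exists V, bad V `<=` S].
have F0P : ProperFilter F0.
  split=> [[V sV]|].
    by have [x /sV] := bad_ex V.
  split=> [|S S' [V VS] [V' VS']|S S' sSS' [V VS]].
  - by have [V _] := fin_nsub_whole G; exists V.
  - have [W WP] := fin_nsub_meet V V'.
    exists W => x xW; split; [apply: VS|apply: VS'];
      by apply: bad_sub xW => y /WP[].
  - by exists V => x /VS/sSS'.
have [F [FU sF0F]] := ultraFilterLemma F0P.
have lim (iV : 'I_n * finite_index_normal G) : exists q : quotient_group iV.2,
    F [set x | coordinate (x iV.1) iV.2 = q].
  exact: ultra_finite_fiber (fin_index iV.2).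
(* The residues selected by the ultrafilter are compatible, hence they are the coordinates of a
   limit point [z]. *)
pose u i (V : finite_index_normal G) :
  quotient_group V := projT1 (cid (lim (i, V))).
have uP i V : F [set x | coordinate (x i) V = u i V] :=
  projT2 (cid (lim (i, V))).
have uC i (V W : finite_index_normal G) : {subset V <= W} ->
  quotient_proj W (u i V) = u i W.
  move=> sVW; have [x [/= <- <-]] := filter_ex (filterI (uP i V) (uP i W)).
  exact: coordinateP.
pose z i := profinite_mk (uC i).
have /nbhs_coordinate_sub[V fV] : nbhs (z : {ptws 'I_n -> K})
    [set x | f x = f z].
  exact: (cf z _ (discrete_set1 (f z : discrete_topology A))).
have FV : F [set x | forall i, coordinate (x i) V = u i V].
  exact: (filter_forall _ (fun i => uP i V)).
have Fbad : F (bad V) by apply: sF0F; exists V.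
(* A bad point close to [z] has a partner congruent to it modulo [V]; both then take the value
   [f z]. *)
have [x [/= xz [y xy]]] := filter_ex (filterI FV Fbad); apply.
by rewrite [LHS]fV ?[RHS]fV // => i; rewrite -xy xz.
Qed.

Lemma action_continuous (A : gmodule K) (V : finite_index_normal G) :
  (forall x y, coordinate x V = coordinate y V ->
    forall a : A, gact x a = gact y a) ->
  continuous (fun xa : K * discrete_topology A =>
    gact xa.1 xa.2 : discrete_topology A).
Proof.
move=> AV [x a] B Bxa; have {}Bxa : B (gact x a) := nbhs_singleton Bxa.
exists ([set y : K | coordinate y V = coordinate x V], [set a]); last first.
  by move=> [y b] [/= /AV xy ->]; rewrite /= xy.
split=> /=; last exact: discrete_set1.
exact: (coordinate_continuous (discrete_set1 _)).
Qed.

(** For fixed [a] the orbit map is a continuous 1-cochain, hence constant modulo some [V];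
    finiteness of [A] allows these subgroups to be intersected. *)
Lemma fdm_action (A : finite_discrete_module K) :
  exists V : finite_index_normal G, forall x y,
    coordinate x V = coordinate y V -> forall a : A, gact x a = gact y a.
Proof.
have actV (a : A) : exists V : finite_index_normal G, forall x y,
    coordinate x V = coordinate y V -> gact x a = gact y a.
  have /continuous_cochainP[V VP] :
      (fun g => gact (g ord0) a) \in @continuous_cochains K A 1.
    rewrite inE => z B Bz.
    have [[P Q] [/= Pz Qa] PQB] := @fdm_continuous _ A (z ord0, a) B Bz.
    suff: nbhs (z : {ptws 'I_1 -> K}) [set x | P (x ord0)].
      apply: (@filterS _ _ (nbhs_filter (z : {ptws 'I_1 -> K}))) => x Px.
      by apply: (PQB (x ord0, a)); split=> //; apply: nbhs_singleton.
    exact: (@proj_continuous _ (fun _ : 'I_1 => K : topologicalType) ord0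
      (z : {ptws 'I_1 -> K}) P).
  by exists V => x y xy; apply: (VP (fun=> x) (fun=> y)).
have [V VP] := choice actV; have /finite_seqP[s sA] := fdm_finite A.
have [W WP] := fin_nsub_seq s V; exists W => x y xy a; apply: (VP a).
apply: coordinate_sub xy; apply: WP.
by have : [set: A] a by []; rewrite sA.
Qed.

End ProfiniteContinuity.

(** * The bar complex *)

Import GRing.Theory.
Local Open Scope ring_scope.

Section Cons.
Variables (T : Type) (n : nat).

Definition cons_fun (x : T) (g : 'I_n -> T) : 'I_n.+1 -> T :=
  fun k => oapp g x (unlift ord0 k).

Lemma cons_fun0 x g : cons_fun x g ord0 = x.
Proof. by rewrite /cons_fun unlift_none. Qed.

Lemma cons_funS x g k : cons_fun x g (lift ord0 k) = g k.
Proof. by rewrite /cons_fun liftK. Qed.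

Lemma cons_fun_tail x g : (fun k => cons_fun x g (lift ord0 k)) = g.
Proof. by apply: functional_extensionality_dep => k; rewrite cons_funS. Qed.

Lemma cons_fun_eta (g : 'I_n.+1 -> T) :
  cons_fun (g ord0) (fun k => g (lift ord0 k)) = g.
Proof.
apply: functional_extensionality_dep => k.
by case: (unliftP ord0 k) => [j|] ->; rewrite ?cons_funS ?cons_fun0.
Qed.

End Cons.

Lemma ord0_funE (T : Type) (g h : 'I_0 -> T) : g = h.
Proof. by apply: functional_extensionality_dep => -[]. Qed.

Lemma ord1_funE (T : Type) (g : 'I_1 -> T) : g = fun=> g ord0.
Proof. by apply: functional_extensionality_dep => k; rewrite (ord1 k). Qed.

Lemma cons_fun_ord0 (T : Type) x (g : 'I_0 -> T) : cons_fun x g = fun=> x.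
Proof. by rewrite [LHS]ord1_funE cons_fun0. Qed.

HB.instance Definition _ (G : groupType) (A : gmodule G) x :=
  GRing.isZmodMorphism.Build A A (gact x) (gactB x).

Section Naturality.
Variables (K Q : groupType) (phi : K -> Q).
Hypothesis phiM : {morph phi : x y / (x * y)%g}.
Variables (M : gmodule Q) (N : gmodule K) (theta : M -> N).
Hypothesis thetaB : zmod_morphism theta.
Hypothesis theta_act : forall x m, theta (gact (phi x) m) = gact x (theta m).

HB.instance Definition _ := GRing.isZmodMorphism.Build M N theta thetaB.

Lemma contract_natural n (j : 'I_n) (g : 'I_n.+1 -> K) :
  (fun k => phi (contract j g k)) = contract j (fun k => phi (g k)).
Proof.
apply: functional_extensionality_dep => k; rewrite /contract.
by case: ifP => // _; case: ifP => // _; rewrite phiM.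
Qed.

(** This covers change of group along [phi] and of coefficients along [theta] at once: inflation is
    the case [theta = id], a coefficient map the case [phi = id]. *)
Lemma differential_natural n (f : cochain M n) :
  differential ((fun g => theta (f (fun k => phi (g k)))) : cochain N n) =
  fun g => theta (differential f (fun k => phi (g k))).
Proof.
apply: functional_extensionality_dep => g; rewrite /differential.
rewrite !raddfD /= theta_act raddf_sum raddfMz; congr (_ + _ + _).
by apply: eq_bigr => j _; rewrite raddfMz contract_natural.
Qed.

End Naturality.

Section LowDegree.
Variables (G : groupType) (A : gmodule G).

Lemma differential_cons n (f : cochain A n.+1) x (g : 'I_n.+1 -> G) :
  differential f (cons_fun x g) =
  gact x (f g)
  - (f (cons_fun (x * g ord0)%g (fun k => g (lift ord0 k)))
     + \sum_(j < n) f (cons_fun x (contract j g)) *~ (-1) ^+ j.+1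
     + f (cons_fun x (fun k => g (lift ord_max k))) *~ (-1) ^+ n.+1).
Proof.
have c0 : contract ord0 (cons_fun x g) =
    cons_fun (x * g ord0)%g (fun k => g (lift ord0 k)).
  apply: functional_extensionality_dep => k; rewrite /contract.
  have lmax0 : lift ord_max (ord0 : 'I_n.+1) = ord0 by apply: val_inj.
  case: (unliftP ord0 k) => [j|] ->; last first.
    by rewrite eqxx cons_fun0 cons_funS lmax0 cons_fun0.
  by rewrite [_ == _]eq_sym (negPf (neq_lift _ _)) !cons_funS.
have lmax m (j : 'I_m) : lift (ord_max : 'I_m.+2) (lift (ord0 : 'I_m.+1) j) =
    lift (ord0 : 'I_m.+2) (lift (ord_max : 'I_m.+1) j).
  by apply: val_inj; rewrite /= /bump !leq0n !add1n ltnS addnS.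
have cS j : contract (lift ord0 j) (cons_fun x g) = cons_fun x (contract j g).
  apply: functional_extensionality_dep => k; rewrite /contract.
  have lmax0 : lift ord_max (ord0 : 'I_n.+1) = ord0 by apply: val_inj.
  case: (unliftP ord0 k) => [i|] ->; last by rewrite lmax0 !cons_fun0.
  rewrite !cons_funS lmax cons_funS (inj_eq lift_inj) !lift0 ltnS.
  by [].
have cmax : (fun k => cons_fun x g (lift ord_max k)) =
    cons_fun x (fun k => g (lift ord_max k)).
  apply: functional_extensionality_dep => k.
  have lmax0 : lift ord_max (ord0 : 'I_n.+1) = ord0 by apply: val_inj.
  case: (unliftP ord0 k) => [i|] ->; last by rewrite lmax0 !cons_fun0.
  by rewrite lmax !cons_funS.
rewrite /differential cons_fun0 cons_fun_tail big_ord_recl c0 cmax expr1.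
rewrite mulrN1z !opprD -!addrA; congr (_ + (_ + _)); rewrite -sumrN;
  congr (_ + _).
  apply: eq_bigr => j _; rewrite cS [in LHS]lift0 exprS mulN1r mulrNz.
  by [].
by rewrite exprS mulN1r mulrNz.
Qed.

Lemma differential0E (f : cochain A 0) x h :
  differential f (fun=> x) = gact x (f h) - f h.
Proof.
rewrite /differential big_ord0 addr0 expr1 mulrN1z.
by congr (gact x (f _) - f _); apply: ord0_funE.
Qed.

Lemma differential1E (f : cochain A 1) x y :
  differential f (cons_fun x (fun=> y)) =
  gact x (f (fun=> y)) - f (fun=> (x * y)%g) + f (fun=> x).
Proof.
rewrite differential_cons big_ord0 addr0 expr1 mulrN1z.
by rewrite !cons_fun_ord0 opprB addrA addrAC.
Qed.

Lemma differential2E (f : cochain A 2) x y z :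
  differential f (cons_fun x (cons_fun y (fun=> z))) =
  gact x (f (cons_fun y (fun=> z))) - f (cons_fun (x * y)%g (fun=> z))
  + f (cons_fun x (fun=> (y * z)%g)) - f (cons_fun x (fun=> y)).
Proof.
rewrite differential_cons big_ord_recl big_ord0 addr0 expr1 mulrN1z.
rewrite cons_fun0 cons_fun_tail !opprD opprK -mulN1r exprS mulrA mulrNN mul1r.
rewrite mulr1z addrA addrA; congr (_ - _ + f _ - f _).
  congr cons_fun; rewrite [LHS]ord1_funE.
  apply: functional_extensionality_dep => _; rewrite /contract ltnn eqxx.
  have -> : lift (ord_max : 'I_2) (ord0 : 'I_1) = ord0 by apply: val_inj.
  by rewrite cons_fun0 cons_funS.
congr cons_fun; apply: functional_extensionality_dep => k; rewrite (ord1 k).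
have -> : lift (ord_max : 'I_2) (ord0 : 'I_1) = ord0 by apply: val_inj.
by rewrite cons_fun0.
Qed.

End LowDegree.

(** * Function modules and the contracting homotopy *)

Section Homotopy.
Variables (Q : groupType) (A : gmodule Q).

(** The diagonal action: the constant functions form a copy of [A], and cocycles of positive degree
    with constant values become coboundaries. *)
Definition function_act (g : Q) (u : Q -> A) : Q -> A :=
  fun x => gact g (u (g^-1 * x)%g).

Fact function_act1 u : function_act 1%g u = u.
Proof.
apply: functional_extensionality_dep => x.
by rewrite /function_act gact1 invg1 mul1g.
Qed.

Fact function_actM x y u :
  function_act (x * y)%g u = function_act x (function_act y u).
Proof.
apply: functional_extensionality_dep => z.
by rewrite /function_act gactM invgM mulgA.
Qed.

Fact function_actB x : {morph function_act x : u v / u - v}.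
Proof. by move=> u v; apply: functional_extensionality_dep => z;
  apply: gactB. Qed.

Definition function_module : gmodule Q :=
  GModule function_act1 function_actM function_actB.

Definition homotopy n (f : cochain A n.+1) : cochain function_module n :=
  fun g x => gact x (f (cons_fun x^-1%g g)).

Definition function_eval (x : Q) (u : function_module) : A := u x.

Fact function_eval_is_zmod_morphism x : zmod_morphism (function_eval x).
Proof. by []. Qed.

HB.instance Definition _ x := GRing.isZmodMorphism.Build function_module A
  (function_eval x) (function_eval_is_zmod_morphism x).

(** The terms match one by one, since the diagonal action of [g ord0] replaces [x^-1] by
    [x^-1 * g ord0]. In particular a cocycle [f] bounds its own [homotopy] once viewed in the
    function module. *)
Lemma homotopy_differential n (f : cochain A n.+1) g x :
  differential (homotopy f) g x = f g - homotopy (differential f) g x.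
Proof.
rewrite [in RHS]/homotopy differential_cons gactB -gactM mulgV gact1.
rewrite opprB addrC subrK !raddfD raddf_sum raddfMz.
rewrite [LHS]/differential -[LHS]/(function_eval x _) !raddfD raddf_sum raddfMz.
congr (_ + _ + _).
- rewrite -[LHS]/(gact (g ord0) (gact ((g ord0)^-1 * x)%g (f _))) -gactM mulVKg.
  by rewrite invgM invgK.
- by apply: eq_bigr => j _; rewrite !raddfMz.
Qed.

Definition const_function (a : A) : function_module := fun=> a.

Lemma differential_const n (f : cochain A n) :
  differential ((fun g => const_function (f g)) : cochain function_module n) =
  fun g => const_function (differential f g).
Proof. exact: (@differential_natural _ _ id _ A function_module
  const_function). Qed.

End Homotopy.

(* Induction on the degree: the homotopy [h] is injective, and the homotopy
   formula gives [h d d f = - d d h f]. *)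
Lemma differential_differential (Q : groupType) n (A : gmodule Q)
  (f : cochain A n) : differential (differential f) = 0.
Proof.
elim: n A f => [|n IHn] A f.
  apply: functional_extensionality_dep => g.
  rewrite -(cons_fun_eta g) (ord1_funE (fun k => g _)).
  rewrite differential1E !(differential0E f _ (fun k =>
    g (lift ord0 (lift ord0 k)))).
  by rewrite gactB -gactM opprB addrC addrA [_ - _ + (_ - _)]addrC subrKA
    subrKA subrr.
have hdd : homotopy (differential (differential f)) = 0.
  apply: functional_extensionality_dep => g;
    apply: functional_extensionality_dep => x.
  have hd : homotopy (differential f) =
      (fun g x => f g) - differential (homotopy f) :> cochain (function_module
        A) _.
    apply: functional_extensionality_dep => g'.
    apply: functional_extensionality_dep => x'.
    rewrite -[RHS]/(f g' - differential (homotopy f) g' x').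
    by rewrite homotopy_differential opprB addrC subrK.
  have := homotopy_differential (differential f) g x.
  rewrite hd raddfB /= IHn subr0 (differential_const f) => /eqP.
  by rewrite -subr_eq0 opprB addrC subrK => /eqP.
apply: functional_extensionality_dep => g; rewrite -(cons_fun_eta g).
have /(congr1 (fun u => u (fun k => g (lift ord0 k)) (g ord0)^-1%g)) := hdd.
rewrite /homotopy invgK => /(congr1 (gact (g ord0))).
by rewrite -gactM mulgV gact1 raddf0.
Qed.

(** * The comparison map in terms of cochains *)

Section Cohomology.
Variables (G : groupType) (A : gmodule G).
Variable C : forall n, zmodClosed (cochain A n).

Lemma cohomology_piP n (f h : cocycle C n) :
  \pi_(cohomology C n) f = \pi_(cohomology C n) h <->
  coboundaries C (cocycle_val f - cocycle_val h).
Proof.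
have -> : cocycle_val f - cocycle_val h = cocycle_val (f - h).
  by rewrite raddfB.
by split=> [/eqP|Bfh]; [|apply/eqP]; rewrite -Quotient.idealrBE !inE.
Qed.

Lemma cocycle_spec n (f : cocycle C n) :
  (f : cochain A n) \in C n /\ differential (f : cochain A n) = 0.
Proof. by have := cocycleP f; rewrite inE => /andP[-> /eqP]. Qed.

Lemma cocycle_of n (f : cochain A n) : f \in C n -> differential f = 0 ->
  exists c : cocycle C n, c = f :> cochain A n.
Proof.
move=> Cf df; have fP : f \in is_cocycle C (n := n)
  by rewrite inE /= Cf df eqxx.
by exists (Cocycle fP).
Qed.

End Cohomology.

Section Comparison.
Variables (G : groupType) (A : gmodule (profinite_completion G)).
Notation Cc := (fun n => @continuous_cochains _ A n).
Notation Ca := (fun n => @all_cochains G (restrict A) n).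

Lemma comparison_surjectiveP n :
  (forall y, exists x, @comparison G A n x = y) <->
  forall f : cochain (restrict A) n, differential f = 0 ->
    exists c : cochain A n, [/\ c \in Cc n, differential c = 0 &
      coboundaries Ca (f - restrict_cochain c)].
Proof.
split=> [surj f df|surj y].
  have [z zf] := @cocycle_of _ _ Ca n f isT df.
  have [x] := surj (\pi_(group_cohomology (restrict A) n) z).
  rewrite -[x]reprK comparison_pi => /esym/cohomology_piP.
  rewrite zf; have [Cx dx] := cocycle_spec (repr x).
  by exists (repr x).
have [_ df] := cocycle_spec (repr y).
have [c [Cc_c dc fc]] := surj _ df.
have [z zc] := cocycle_of Cc_c dc.
exists (\pi_(continuous_cohomology A n) z).
rewrite comparison_pi -[RHS]reprK; apply/esym/cohomology_piP.
by rewrite /restrict_cocycle /= zc.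
Qed.

Lemma comparison_injective n :
  (forall c : cochain A n, c \in Cc n -> differential c = 0 ->
    coboundaries Ca (restrict_cochain c) -> coboundaries Cc c) ->
  injective (@comparison G A n).
Proof.
move=> inj x y; rewrite -[x]reprK -[y]reprK !comparison_pi =>
  /cohomology_piP xy.
apply/cohomology_piP.
have [Cxy dxy] := cocycle_spec (repr x - repr y).
have := inj _ Cxy dxy; rewrite !raddfB; apply; exact: xy.
Qed.

End Comparison.

Lemma inj_surj_bijective (S T : choiceType) (f : S -> T) :
  injective f -> (forall y, exists x, f x = y) -> bijective f.
Proof.
move=> f_inj f_surj; have [g fg] := choice f_surj.
by exists g => // x; apply: f_inj.
Qed.

(* Through [vanishing_proj], the functions vanishing at [1] are the quotient of
   [function_module A] by the constant functions. *)
Section VanishingFunctions.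
Variables (Q : groupType) (A : gmodule Q).

Definition vanishing : {pred Q -> A} := [pred u : Q -> A | u 1%g == 0].

Fact vanishing_zmod_closed : zmod_closed vanishing.
Proof.
split=> [|u v]; rewrite !inE; first exact/eqP.
by move=> /eqP u1 /eqP v1; rewrite -[(u - v) _]/(u _ - v _) u1 v1 subrr.
Qed.

HB.instance Definition _ := GRing.isZmodClosed.Build (Q -> A) vanishing
  vanishing_zmod_closed.

Record vanishing_function := VanishingFunction {
  vanishing_val :> Q -> A; vanishingP : vanishing_val \in vanishing }.

HB.instance Definition _ := [isSub for vanishing_val].
HB.instance Definition _ := [Choice of vanishing_function by <:].
HB.instance Definition _ := [SubChoice_isSubZmodule of vanishing_function
  by <:].

Fact vanishing_proj_subproof (u : Q -> A) :
  u - const_function (u 1%g) \in vanishing.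
Proof. by rewrite inE; apply/eqP/subrr. Qed.

Definition vanishing_proj (u : Q ->
  A) := VanishingFunction (vanishing_proj_subproof u).

Lemma vanishing_proj_is_zmod_morphism : zmod_morphism vanishing_proj.
Proof.
move=> u v; apply: val_inj; apply: functional_extensionality_dep => x.
rewrite raddfB /= -[LHS]/(u x - v x - (u 1%g - v 1%g)).
by rewrite -[RHS]/(u x - u 1%g - (v x - v 1%g)) !opprD !opprK addrACA.
Qed.

Lemma vanishing_val_is_zmod_morphism : zmod_morphism vanishing_val.
Proof. exact: (raddfB (val : vanishing_function -> (Q -> A))). Qed.

Lemma vanishing_projK (u : vanishing_function) : vanishing_proj u = u.
Proof.
apply: val_inj; apply: functional_extensionality_dep => x.
have /eqP u1 := vanishingP u.
by rewrite -[LHS]/(u x - u 1%g) u1 subr0.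
Qed.

Lemma vanishing_proj_eq0 (u : Q -> A) :
  vanishing_proj u = 0 <-> u = const_function (u 1%g).
Proof.
split=> [/(congr1 vanishing_val)/eqP|->].
  by rewrite -[_ == _]/(u - _ == 0) subr_eq0 => /eqP.
by apply: val_inj; apply: functional_extensionality_dep => x; apply: subrr.
Qed.

(** Translation moves the base point [1], so the value there is subtracted again; this is the action
    that makes [vanishing_proj] equivariant. *)
Definition vanishing_act (g : Q) (u : vanishing_function) :
  vanishing_function :=
  vanishing_proj (function_act g u).

Lemma vanishing_proj_act g (u : Q -> A) :
  vanishing_proj (function_act g u) = vanishing_act g (vanishing_proj u).
Proof.
apply: val_inj; apply: functional_extensionality_dep => x.
rewrite -[LHS]/(gact g (u _) - gact g (u _)).
rewrite -[RHS]/(gact g (u _ - u _) - gact g (u _ - u _)) !gactB.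
by rewrite opprB addrA subrK.
Qed.

Fact vanishing_act1 u : vanishing_act 1%g u = u.
Proof. by rewrite /vanishing_act function_act1 vanishing_projK. Qed.

Fact vanishing_actM x y u :
  vanishing_act (x * y)%g u = vanishing_act x (vanishing_act y u).
Proof. by rewrite /vanishing_act function_actM vanishing_proj_act. Qed.

Fact vanishing_actB x : {morph vanishing_act x : u v / u - v}.
Proof.
move=> u v; rewrite -vanishing_proj_is_zmod_morphism -function_actB.
by rewrite -vanishing_val_is_zmod_morphism.
Qed.

Definition vanishing_module : gmodule Q :=
  GModule vanishing_act1 vanishing_actM vanishing_actB.

End VanishingFunctions.

(** * Inflation from finite quotients and extension of cocycles to the completion *)

Section Inflation.
Variables (G : groupType) (V : finite_index_normal G).
Notation K := (profinite_completion G).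
Notation Q := (quotient_group V).

Definition lift_quotient (q : Q) : K := completion_map (repr q).

Lemma lift_quotientK q : coordinate (lift_quotient q) V = q.
Proof. exact: reprK. Qed.

Lemma coordinateM : {morph (fun x : K => coordinate x V) : x y / (x * y)%g}.
Proof. by []. Qed.

Section InflatedModule.
Variable M : gmodule Q.

Fact inflate_act1 (m : M) : gact (coordinate (1%g : K) V) m = m.
Proof. exact: gact1. Qed.

Fact inflate_actM (x y : K) (m : M) : gact (coordinate (x * y)%g V) m =
  gact (coordinate x V) (gact (coordinate y V) m).
Proof. exact: gactM. Qed.

Definition inflate : gmodule K :=
  @GModule K M (fun x => gact (coordinate x V)) inflate_act1 inflate_actM
    (fun x => gactB (coordinate x V)).

Fact inflate_continuous : continuous (fun xa : K * discrete_topology inflate =>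
  gact xa.1 xa.2 : discrete_topology inflate).
Proof.
by apply: (@action_continuous _ _ V) => x y xy a; rewrite /inflate /= xy.
Qed.

Definition inflate_finite (finM : finite_set [set: M]) :
    finite_discrete_module K :=
  @FiniteDiscreteModule _ inflate finM inflate_continuous.

End InflatedModule.

Section QuotientModule.
Variable A : gmodule K.
Hypothesis actV : forall x y, coordinate x V = coordinate y V ->
  forall a : A, gact x a = gact y a.

Fact quotient_act1 (a : A) : gact (lift_quotient 1%g) a = a.
Proof. by rewrite -[RHS]gact1; apply: actV; rewrite lift_quotientK. Qed.

Fact quotient_actM q r (a : A) : gact (lift_quotient (q * r)%g) a =
  gact (lift_quotient q) (gact (lift_quotient r) a).
Proof.
by rewrite -gactM; apply: actV; rewrite coordinateM !lift_quotientK.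
Qed.

Definition quotient_module : gmodule Q :=
  @GModule Q A (fun q => gact (lift_quotient q)) quotient_act1 quotient_actM
    (fun q => gactB (lift_quotient q)).

Lemma quotient_module_act x (a : A) :
  gact (coordinate x V : Q) (a : quotient_module) = gact x a.
Proof. by apply: actV; rewrite lift_quotientK. Qed.

Lemma differential_quotient n (f : cochain quotient_module n) (x : 'I_n.+1 ->
  K) :
  differential ((fun y => f (fun k => coordinate (y k) V)) : cochain A n) x =
  differential f (fun k => coordinate (x k) V).
Proof.
rewrite (@differential_natural _ _ _ coordinateM quotient_module A id) //.
exact: quotient_module_act.
Qed.

Lemma differential_invariant n (c : cochain A n) :
  (forall x y, (forall i, coordinate (x i) V = coordinate (y i) V) ->
    c x = c y) ->
  forall x y, (forall i, coordinate (x i) V = coordinate (y i) V) ->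
  differential c x = differential c y.
Proof.
move=> cV; pose f : cochain quotient_module n :=
  fun q => c (fun k => lift_quotient (q k)).
have -> : c = fun y => f (fun k => coordinate (y k) V).
  by apply: functional_extensionality_dep => y; apply: cV => i;
    rewrite lift_quotientK.
move=> x y xy; rewrite !differential_quotient; congr (differential f _).
exact: functional_extensionality_dep.
Qed.

(** [G] and its completion have the same residues modulo [V], so [f] determines [c], and the cocycle
    identity at any tuple follows from its instance at representatives in [G]. *)
Lemma extend_cocycle n (f : cochain (restrict A) n) :
  (forall x y, (forall i, \pi_Q (x i) = \pi_Q (y i)) -> f x = f y) ->
  differential f = 0 ->
  exists c : cochain A n, [/\ c \in @continuous_cochains K A n,
    differential c = 0 & restrict_cochain c = f].
Proof.
move=> fV df; pose c : cochain A n :=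
  fun x => f (fun k => repr (coordinate (x k) V)).
have cV x y : (forall i, coordinate (x i) V = coordinate (y i) V) -> c x = c y.
  by move=> xy; congr f; apply: functional_extensionality_dep => k; rewrite xy.
have cf : restrict_cochain c = f.
  apply: functional_extensionality_dep => g; apply: fV => i; exact: reprK.
exists c; split=> //; first by apply/continuous_cochainP; exists V.
apply: functional_extensionality_dep => x.
rewrite (@differential_invariant _ _ cV x (fun k =>
  lift_quotient (coordinate (x k) V))).
  have := restrict_differential c; rewrite cf df.
  by move=> /(congr1 (fun u => u (fun k => repr (coordinate (x k) V))))/esym.
by move=> i; rewrite lift_quotientK.
Qed.

End QuotientModule.
End Inflation.

(** * Comparison in low degrees *)

Section LowDegreeComparison.
Variable G : groupType.
Notation K := (profinite_completion G).

(** All coefficient modules are quantified at once because dimension shifting and Shapiro's lemma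
    both change the module. *)
Definition comparison_onto n := forall (A : finite_discrete_module K)
  (f : cochain (restrict A) n), differential f = 0 ->
  exists c : cochain A n, [/\ c \in @continuous_cochains K A n,
    differential c = 0 &
    coboundaries (fun n => @all_cochains G (restrict A) n) (f -
      restrict_cochain c)].

Definition comparison_into n := forall (A : finite_discrete_module K)
  (c : cochain A n), c \in @continuous_cochains K A n -> differential c = 0 ->
  coboundaries (fun n => @all_cochains G (restrict A) n) (restrict_cochain c) ->
  coboundaries (fun n => @continuous_cochains K A n) c.

Lemma coboundaries0 (H : groupType) (A : gmodule H)
  (C : forall n, zmodClosed (cochain A n)) n : coboundaries C (0 : cochain A n).
Proof. by case: n => [|n] //=; exists 0; rewrite ?rpred0 ?raddf0. Qed.

Lemma comparison_onto0 : comparison_onto 0.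
Proof.
move=> A f df; have [V actV] := fdm_action A.
have [|c [Cc dc cf]] := extend_cocycle actV _ df.
  by move=> x y _; rewrite (ord0_funE x y).
by exists c; split=> //; rewrite cf subrr.
Qed.

Lemma cocycle1M (H : groupType) (A : gmodule H) (f : cochain A 1) :
  differential f = 0 -> forall x y,
  f (fun=> (x * y)%g) = f (fun=> x) + gact x (f (fun=> y)).
Proof.
move=> df x y; apply/esym/eqP;
  rewrite addrC -subr_eq0 addrAC -differential1E df.
exact/eqP.
Qed.

(** On [V], which acts trivially, a cocycle is a homomorphism to a finite group; its kernel [W]
    there has finite index, and the cocycle factors through [G / W]. *)
Lemma comparison_onto1 : comparison_onto 1.
Proof.
move=> A f df; have [V actV] := fdm_action A; have fM := cocycle1M df.
have act1 x : x \in V -> forall a : A, gact (completion_map x) a = a.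
  move=> xV a; rewrite -[RHS]gact1; apply: actV.
  by apply/eqP; rewrite -[_ == _]/(\pi_(quotient_group V) x == 1%g);
    apply/eqP/pi_eq1.
have f1 : f (fun=> 1%g) = 0.
  by have /eqP := fM 1%g 1%g; rewrite mulg1 gact1 -subr_eq subrr eq_sym => /eqP.
have [F [e eP]] := finite_index_code V.
have /finite_typeP[F' [e' e'_inj]] := fdm_finite A.
have fVx x y : f (fun=> x) = f (fun=> y) -> f (fun=> (x^-1 * y)%g) = 0.
  by move=> fxy; rewrite fM -fxy -fM mulVg.
have [W WP] : exists W : finite_index_normal G, forall x,
    x \in W <-> x \in V /\ f (fun=> x) = 0.
  apply: fin_nsub_of => [|x y [xV fx] [yV fy]|x [xV fx]|x y [xV fx]|].
  - by rewrite nsub1.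
  - by rewrite nsubM // fM fx fy raddf0 addr0.
  - by rewrite nsubV // -[x^-1%g]mulg1 fVx ?fx.
  - rewrite nsub_conj // /conjg fM fM fx add0r.
    by split=> //; rewrite -[gact x _]/(gact (completion_map x) _) act1 // -fM
      mulVg.
  exists (F * F')%type, (fun x => (e x, e' (f (fun=> x)))) =>
    x y [/eP xy /e'_inj fxy].
  by split=> //; apply: fVx.
have actW x y : coordinate x W = coordinate y W ->
  forall a : A, gact x a = gact y a.
  by move=> xy; apply: actV; apply: coordinate_sub xy => z /WP[].
have [|c [Cc dc cf]] := extend_cocycle actW _ df.
  move=> x y xy; rewrite (ord1_funE x) (ord1_funE y).
  have /piP/WP[xyV fxy] := xy ord0.
  by rewrite -[y ord0](mulVKg (x ord0)) fM fxy raddf0 addr0.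
by exists c; split=> //; rewrite cf subrr; apply: coboundaries0.
Qed.

Lemma comparison_into0 : comparison_into 0.
Proof.
move=> A c _ _ c0; apply: functional_extensionality_dep => x.
have := congr1 (fun u => u (fun=> 1%g)) c0.
by rewrite /restrict_cochain (ord0_funE (fun k => _) x).
Qed.

(** A 0-cochain is a single element, hence continuous. The identity [db] passes from [G] to the
    completion because both of its sides depend only on residues modulo [W]. *)
Lemma comparison_into1 : comparison_into 1.
Proof.
move=> A c /continuous_cochainP[V cV] dc [b _ db];
  have [V' actV'] := fdm_action A.
have [W WP] := fin_nsub_meet V V'.
exists ((fun=> b (fun=> 1%g)) : cochain A 0).
  by apply/continuous_cochainP; exists V.
apply: functional_extensionality_dep => x; rewrite (ord1_funE x).
have xW := lift_quotientK (coordinate (x ord0) W).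
have sWV : {subset W <= V} by move=> y /WP[].
have sWV' : {subset W <= V'} by move=> y /WP[].
have -> : c (fun=> x ord0) = c (fun=> lift_quotient (coordinate (x ord0) W)).
  by apply: cV => _; apply/esym/(coordinate_sub sWV xW).
rewrite -[RHS]/(restrict_cochain c (fun=> repr (coordinate (x ord0) W))) -db.
rewrite (differential0E b _ (fun=> 1%g)) (differential0E (A :=
  A) _ _ (fun=> 1%g)).
by congr (_ - _); apply/actV'/esym/(coordinate_sub sWV' xW).
Qed.

End LowDegreeComparison.

(** * Dimension shifting *)

Section DimensionShift.
Variable G : groupType.
Notation K := (profinite_completion G).

(* Dimension shifting along [0 -> A -> A' -> A'' -> 0], where [A'] consists of
   the functions on a finite quotient [Q] of [G] through which the given cocycle
   factors, so that it bounds in [A']. *)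
Lemma comparison_into_step m :
  comparison_onto G m.+1 -> comparison_into G m.+1 -> comparison_into G m.+2.
Proof.
move=> onto into A c /continuous_cochainP[V1 cV1] dc [b _ db].
have [V2 actV2] := fdm_action A; have [V VP] := fin_nsub_meet V1 V2.
have sV1 : {subset V <= V1} by move=> x /VP[].
have sV2 : {subset V <= V2} by move=> x /VP[].
have actV x y : coordinate x V = coordinate y V ->
  forall a : A, gact x a = gact y a.
  by move=> xy; apply/actV2/(coordinate_sub sV2).
pose Q := quotient_group V; pose A0 := quotient_module actV.
pose A1 := function_module A0; pose A2 := vanishing_module A0.
have finA1 : finite_set [set: A1].
  exact: finite_functions (fin_index V) (fdm_finite A).
have finA2 : finite_set [set: A2].
  have /finite_typeP[F [e e_inj]] := finA1; apply/finite_typeP.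
  by exists F, (e \o @vanishing_val _ A0) => u v /e_inj/val_inj.
pose A1K := inflate_finite finA1; pose A2K := inflate_finite finA2.
pose iota : A -> A1 := @const_function _ A0.
pose proj : A1 -> A2 := @vanishing_proj _ A0.
have iota_act x a : iota (gact x a) = gact (x : K) (iota a : A1K).
  apply: functional_extensionality_dep => q.
  by apply/esym/(quotient_module_act actV).
have projB : zmod_morphism proj := @vanishing_proj_is_zmod_morphism _ A0.
pose cQ : cochain A0 m.+2 := fun q => c (fun k => lift_quotient (q k)).
have cE x : c x = cQ (fun k => coordinate (x k) V).
  by apply: cV1 => i; apply/esym/(coordinate_sub sV1)/lift_quotientK.
have dcQ : differential cQ = 0.
  apply: functional_extensionality_dep => q.
  have -> : q = fun k => coordinate (lift_quotient (q k)) V.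
    by apply: functional_extensionality_dep => k; rewrite lift_quotientK.
  rewrite -differential_quotient.
  have -> : (fun y => cQ (fun k => coordinate (y k) V)) = c :> cochain A _.
    by apply: functional_extensionality_dep => y; rewrite cE.
  by rewrite dc.
pose beta : cochain A1 m.+1 := homotopy cQ.
have dbeta : differential beta = fun q => iota (cQ q).
  apply: functional_extensionality_dep => q;
    apply: functional_extensionality_dep => x.
  rewrite homotopy_differential dcQ.
  rewrite -[homotopy _ _ _]/(gact x (0 : A0)) raddf0 subr0.
  by [].
pose betaK : cochain A1K m.+1 := fun x => beta (fun k => coordinate (x k) V).
have dbetaK : differential betaK = fun x => iota (c x).
  apply: functional_extensionality_dep => x.
  rewrite (@differential_natural _ _ _ (@coordinateM G V) A1 A1K id) // dbeta.
  by rewrite -cE.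
(* Over [G] the cocycle [c] is bounded twice, by [betaK] in [A1] and by [b] in [A]; the difference
   is a cocycle, to which surjectivity applies. *)
pose u : cochain (restrict A1K) m.+1 :=
  restrict_cochain betaK - (fun g => iota (b g)).
have du : differential u = 0.
  rewrite raddfB /= restrict_differential dbetaK.
  rewrite (@differential_natural _ _ id _ (restrict A) (restrict A1K)
    iota) //.
    by rewrite db; apply: subrr.
  by move=> x a; apply: iota_act.
have [cc [Ccc dcc [gamma _ dgamma]]] := onto A1K u du.
(* The constants [iota (b g)] die in [A2], so [w] restricts on [G] to the coboundary of the image of
   [gamma], and injectivity one degree lower makes it a continuous coboundary. *)
pose w : cochain A2K m.+1 := fun x => proj (betaK x - cc x).
have dw : differential w = 0.
  rewrite (@differential_natural _ _ id _ A1K A2K proj _ _ _ (betaK - cc)) //.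
  - rewrite raddfB /= dcc subr0 dbetaK.
    apply: functional_extensionality_dep => x; exact/vanishing_proj_eq0.
  - by move=> x v; apply: vanishing_proj_act.
have proj_act x (a : A1K) : proj (gact x a) = gact (x : K) (proj a : A2K).
  exact: vanishing_proj_act.
have [V3 cV3] := (continuous_cochainP cc).1 Ccc.
have betaV x y : (forall i, coordinate (x i) V = coordinate (y i) V) ->
    betaK x = betaK y.
  by move=> xy; congr beta; apply: functional_extensionality_dep.
have [epsilon Cepsilon depsilon] :
    coboundaries (fun n => @continuous_cochains K A2K n) w.
  apply: into => //.
    have [W WP] := fin_nsub_meet V V3; apply/continuous_cochainP; exists W.
    move=> x y xy; rewrite /w (betaV x y) ?(cV3 x y) //.
      by move=> i; apply: coordinate_sub (xy i) => z /WP[].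
    by move=> i; apply: coordinate_sub (xy i) => z /WP[].
  exists (fun g => proj (gamma g)) => //.
  rewrite (@differential_natural _ _ id _ (restrict A1K) (restrict A2K) proj)
    //; last first.
    by move=> x a; apply: proj_act.
  apply: functional_extensionality_dep => g; rewrite dgamma.
  rewrite -[LHS]/(proj (betaK (fun k => completion_map (g k)) - iota (b g)
    - cc (fun k => completion_map (g k)))).
  rewrite addrAC projB.
  have -> : proj (iota (b g)) = 0 by apply/vanishing_proj_eq0.
  by rewrite subr0.
have [V4 eV4] := (continuous_cochainP epsilon).1 Cepsilon.
(* Subtracting the coboundary of a lift of [epsilon] leaves [v] with image zero in [A2], that is,
   with constant values [b']; these bound [c] because [cc] is a cocycle. *)
pose eps1 : cochain A1K m := fun x => vanishing_val (epsilon x).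
pose v : cochain A1K m.+1 := betaK - cc - differential eps1.
pose b' : cochain A m.+1 := fun x => v x 1%g.
have vE x : v x = iota (b' x).
  apply/vanishing_proj_eq0.
  rewrite -[LHS]/(proj (betaK x - cc x - differential eps1 x)) projB.
  have := @differential_natural _ _ id _ A1K A2K proj _ proj_act _ eps1.
  have -> : (fun g => proj (eps1 (fun k => g k))) = epsilon :> cochain A2K _.
    apply: functional_extensionality_dep => y; exact: vanishing_projK.
  rewrite depsilon => /(_ _ projB)/(congr1 (fun u => u x)) <- //.
  exact: subrr.
exists b'.
  have [W WP] := fin_nsub_meet V V3; have [W' W'P] := fin_nsub_meet W V4.
  have [sWV sWV3 sWV4] : [/\ {subset W' <= V},
    {subset W' <= V3} & {subset W' <= V4}].
    by split=> z /W'P[] // /WP[].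
  apply/continuous_cochainP; exists W' => x y xy.
  suff vxy : v x = v y by rewrite /b' vxy.
  rewrite -[LHS]/(betaK x - cc x - differential eps1 x).
  rewrite -[RHS]/(betaK y - cc y - differential eps1 y).
  rewrite (betaV x y) => [|i]; last exact: (coordinate_sub sWV).
  rewrite (cV3 x y) => [|i]; last exact: (coordinate_sub sWV3).
  congr (_ - _); apply: differential_invariant xy.
    move=> x' y' xy' a; rewrite -[LHS]/(gact (coordinate x' V) (a : A1)).
    by rewrite (coordinate_sub sWV xy').
  move=> x' y' xy'; rewrite /eps1 (eV4 x' y') // => i.
  exact: (coordinate_sub sWV4).
have dv : differential v = fun x => iota (c x).
  rewrite !raddfB /= dcc subr0 dbetaK.
  by rewrite differential_differential subr0.
apply: functional_extensionality_dep => x.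
have := @differential_natural _ _ id _ A A1K iota _ iota_act _ b'.
have <- : v = fun x => iota (b' x) by apply: functional_extensionality_dep =>
  y; apply: vE.
rewrite dv => /(_ (fun _ _ => erefl) (fun _ _ => erefl)).
by move=> /(congr1 (fun u => u x 1%g))/esym.
Qed.

End DimensionShift.

(** * Extensions defined by 2-cocycles *)

(** The cocycle condition is an argument of the type so that a group structure, whose associativity
    rests on it, can be attached. *)
Definition cocycle_extension (G : groupType) (A : gmodule G) (f : cochain A 2)
  of differential f = 0 : Type := (A * G)%type.

Section CocycleExtension.
Variables (G : groupType) (A : gmodule G) (f : cochain A 2).
Hypothesis df : differential f = 0.

Local Notation F x y := (f (cons_fun x (fun=> y))).

Lemma cocycle2M x y z :
  F x y + F (x * y)%g z = gact x (F y z) + F x (y * z)%g.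
Proof.
apply/esym/eqP; rewrite -subr_eq0 [F x y + _]addrC opprD addrA.
by rewrite (addrAC (gact x (F y z))) -differential2E df; apply/eqP.
Qed.

Lemma cocycle2_1l z : F 1%g z = F 1%g 1%g.
Proof.
by have := cocycle2M 1 1 z; rewrite !mulg1 mul1g gact1 => /addIr.
Qed.

Lemma cocycle2_1r x : F x 1%g = gact x (F 1%g 1%g).
Proof. by have := cocycle2M x 1 1; rewrite !mulg1 => /addIr. Qed.

Local Notation E := (cocycle_extension df).

HB.instance Definition _ := Choice.copy E (A * G)%type.

Implicit Types u v w : E.

Definition ext_pair (a : A) (x : G) : E := (a, x).

Definition ext_mul u v : E :=
  (u.1 + gact u.2 v.1 + F u.2 v.2, (u.2 * v.2)%g).
(** Cocycles are not taken normalized, so the unit carries the correction [- F 1 1], which recurs in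
    [ext_inv] and [ext_incl]. *)
Definition ext_one : E := (- F 1%g 1%g, 1%g).
Definition ext_inv u : E :=
  (- F 1%g 1%g - F u.2^-1%g u.2 - gact u.2^-1%g u.1, u.2^-1%g).

Fact ext_mulA : associative ext_mul.
Proof.
move=> [a x] [b y] [c z]; rewrite /ext_mul /=; congr (_, _); last exact: mulgA.
rewrite !raddfD /= -gactM -!addrA; congr (_ + (_ + _)).
by rewrite [RHS]addrCA cocycle2M.
Qed.

Fact ext_1mul : left_id ext_one ext_mul.
Proof.
move=> [a x]; rewrite /ext_mul /= mul1g gact1 (cocycle2_1l x).
by rewrite addrAC addNr add0r.
Qed.

Fact ext_mul1 : right_id ext_one ext_mul.
Proof.
by move=> [a x]; rewrite /ext_mul /= mulg1 (cocycle2_1r x) raddfN subrK.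
Qed.

Fact ext_mulV : left_inverse ext_one ext_inv ext_mul.
Proof. by move=> [a x]; rewrite /ext_mul /= mulVg !subrK. Qed.

Fact ext_mulVr : right_inverse ext_one ext_inv ext_mul.
Proof.
move=> [a x]; rewrite /ext_mul /= mulgV; congr (_, _).
have := cocycle2M x x^-1%g x;
  rewrite mulgV mulVg (cocycle2_1l x) (cocycle2_1r x) => cx.
rewrite !raddfB raddfN /= -gactM mulgV gact1 addrC addrA.
by rewrite -opprD [_ + gact x (F _ x)]addrC -cx opprD addrACA subrr addr0
  addrA subrr add0r.
Qed.

HB.instance Definition _ := isGroup.Build E
  ext_mulA ext_1mul ext_mul1 ext_mulV ext_mulVr.

Definition ext_incl (a : Algebra.to_multiplicative A) : E :=
  ((a : A) - F 1%g 1%g, 1%g).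

Fact ext_inclM : {morph ext_incl : a b / (a * b)%g}.
Proof.
move=> a b; rewrite -[RHS]/(ext_mul _ _) /ext_mul /= mulg1 gact1; congr (_, _).
rewrite addrA subrK -[(a * b)%g]/(a + b : A).
by rewrite addrAC.
Qed.

HB.instance Definition _ :=
  isMultiplicative.Build (Algebra.to_multiplicative A) E ext_incl ext_inclM.

Definition ext_proj (u : E) : G := u.2.

Fact ext_projM : {morph ext_proj : u v / (u * v)%g}.
Proof. by []. Qed.

HB.instance Definition _ :=
  isMultiplicative.Build E G ext_proj ext_projM.

Lemma cocycle_extensionP :
  group_extension (ext_incl : {multiplicative _ -> _})
    (ext_proj : {multiplicative _ -> _}).
Proof.
split=> [a b [/addIr]|g|[a x]] //; first by exists (0, g).
split=> [/= x1|[b [_ <-]]] //; exists (a + F 1%g 1%g).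
by rewrite /ext_incl addrK; congr (_, _).
Qed.

Lemma ext_incl_mul a b x : (ext_incl a * ext_pair b x)%g = ext_pair (a + b) x.
Proof.
rewrite -[LHS]/(ext_mul _ _) /ext_mul /= mul1g gact1 (cocycle2_1l x).
by rewrite addrAC addrNK.
Qed.

(** Changing the section by [beta] changes the factor set by a coboundary, so looking for an
    inflated cocycle in the class of [f] amounts to looking for a good section. *)
Lemma ext_section_mul (beta : cochain A 1) x y :
  (ext_pair (beta (fun=> x)) x * ext_pair (beta (fun=> y)) y)%g =
  (ext_incl ((f + differential beta) (cons_fun x (fun=> y))) *
    ext_pair (beta (fun=> (x * y)%g)) (x * y)%g)%g.
Proof.
rewrite ext_incl_mul -[LHS]/(ext_mul _ _) /ext_mul /=; congr (_, _).
rewrite -[(f + _) _]/(f _ + differential beta _) differential1E.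
by rewrite addrC -[RHS]addrA (addrAC (_ - _)) subrK (addrC (gact _ _)).
Qed.

End CocycleExtension.

(** When [D] meets [A] trivially, an element of [A] is determined by its class modulo [D]. A section
    whose class modulo [D] depends only on a finite quotient of [G] therefore has a factor set with
    the same property. *)
Lemma comparison_onto2 (G : groupType) :
  (forall (F E : groupType)
     (i : {multiplicative F -> E}) (p : {multiplicative E -> G}),
     group_extension i p -> finite_set [set: F] -> residually_finite E) ->
  comparison_onto G 2.
Proof.
move=> ext_rf A f df; have [V actV] := fdm_action A.
have := ext_rf _ _ _ _ (cocycle_extensionP df) (fdm_finite A) => rfE.
have [D D_incl] : exists D : finite_index_normal (cocycle_extension df),
    forall a, ext_incl df a \in D -> a = 0.
  have sep (a : A) : exists N : finite_index_normal (cocycle_extension df),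
      ext_incl df a \in N -> a = 0.
    have [a0|a0] := eqVneq a 0;
      first by have [N _] := fin_nsub_whole (cocycle_extension df); exists N.
    have [|N aN] := rfE (ext_incl df a); last by exists N => aN';
      rewrite aN' in aN.
    move=> /(congr1 (@fst A G)) /= /eqP.
    by rewrite -[RHS in _ == RHS]add0r (inj_eq (addIr _)) (negPf a0).
  have [N NP] := choice sep; have /finite_seqP[s sA] := fdm_finite A.
  have [D DP] := fin_nsub_seq s N; exists D => a aD; apply: NP; apply: DP aD.
  by have : [set: A] a by []; rewrite sA.
have [V0 V0P] := fin_nsub_image (ext_surjective (cocycle_extensionP df)) D.
pose r x : G := repr (\pi_(quotient_group V0) x).
(* The element over [x] is [(0, r x)] times an element of [D] over [(r x)^-1 * x], which exists
   because [V0] is the image of [D]. *)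
have section_ex x : exists b, \pi_(quotient_group D) (ext_pair df b x) =
    \pi_(quotient_group D) (ext_pair df 0 (r x)).
  have /V0P[[a y] dD yE] : ((r x)^-1 * x)%g \in V0 by apply/piP; rewrite reprK.
  pose u : cocycle_extension df := (ext_pair df 0 (r x) * ext_pair df a y)%g.
  have uE : ext_pair df u.1 x = u.
    have {}yE : y = ((r x)^-1 * x)%g := yE.
    by rewrite /u yE; congr (_, _); rewrite /= mulVKg.
  by exists u.1; apply/esym/piP; rewrite uE mulKg.
have [b bP] := choice section_ex.
pose beta : cochain (restrict A) 1 := fun g => b (g ord0).
pose f' : cochain (restrict A) 2 := f + differential beta.
have [W WP] := fin_nsub_meet V V0.
have actW x y : coordinate x W = coordinate y W ->
  forall a : A, gact x a = gact y a.
  by move=> xy; apply: actV; apply: coordinate_sub xy => z /WP[].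
have pi_b x y : \pi_(quotient_group W) x = \pi_(quotient_group W) y ->
    \pi_(quotient_group D) (ext_pair df (b x) x) = \pi_(quotient_group D)
      (ext_pair df (b y) y).
  by move=> /piP/WP[_ /piP xy]; rewrite !bP /r xy.
have f'W x y x' y' : \pi_(quotient_group W) x = \pi_(quotient_group W) x' ->
    \pi_(quotient_group W) y = \pi_(quotient_group W) y' ->
    f' (cons_fun x (fun=> y)) = f' (cons_fun x' (fun=> y')).
  move=> xx' yy'.
  have xy : \pi_(quotient_group W) (x * y)%g = \pi_(quotient_group W) (x' *
    y')%g.
    by rewrite !piM xx' yy'.
  have := congr1 (\pi_(quotient_group D)) (ext_section_mul df beta x y).
  have := congr1 (\pi_(quotient_group D)) (ext_section_mul df beta x' y').
  rewrite !piM (pi_b _ _ xx') (pi_b _ _ yy') (pi_b _ _ xy) => -> /mulIg.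
  move=> /piP; rewrite -morphV -gmulfM => /D_incl.
  by move=> /eqP; rewrite -[_ == _]/(- f' _ + f' _ == 0) addrC subr_eq0 => /eqP.
have [||c [Cc dc cf]] := extend_cocycle actW (f := f').
- move=> x y xy; rewrite -(cons_fun_eta x) -(cons_fun_eta y).
  rewrite (ord1_funE (fun k => x _)) (ord1_funE (fun k => y _)).
  exact: f'W.
- by rewrite raddfD /= df differential_differential addr0.
exists c; split=> //; exists (- beta) => //.
by rewrite raddfN cf /f' [in RHS]opprD addNKr.
Qed.

(** * Extensions with finite kernel *)

Definition abelian_sub (E : groupType) (S : {pred E}) of group_closed S &
  {in S &, commutative (fun x y : E => x * y)%g} : Type := {x : E | x \in S}.

Section AbelianSubgroup.
Local Open Scope group_scope.
Variables (E : groupType) (S : {pred E}).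
Hypotheses (gS : group_closed S)
  (cS : {in S &, commutative (fun x y : E => x * y)%g}).

Local Notation T := (abelian_sub gS cS).

HB.instance Definition _ := SubChoice.copy T {x : E | x \in S}.

Fact absub_add_subproof (x y : T) : val x * val y \in S.
Proof. exact: (group_closedM gS) (valP x) (valP y). Qed.
Fact absub_opp_subproof (x : T) : (val x)^-1 \in S.
Proof. exact: (group_closedV gS) (valP x). Qed.
Fact absub_zero_subproof : 1 \in S.
Proof. by case: gS. Qed.

Definition absub_add (x y : T) : T := exist (fun x =>
  x \in S) _ (absub_add_subproof x y).
Definition absub_opp (x : T) : T := exist (fun x =>
  x \in S) _ (absub_opp_subproof x).
Definition absub_zero : T := exist (fun x => x \in S) _ absub_zero_subproof.

Fact absub_addA : associative absub_add.
Proof. by move=> x y z; apply: val_inj; apply: mulgA. Qed.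
Fact absub_addC : commutative absub_add.
Proof. by move=> x y; apply: val_inj; apply: cS; apply: valP. Qed.
Fact absub_add0 : left_id absub_zero absub_add.
Proof. by move=> x; apply: val_inj; apply: mul1g. Qed.
Fact absub_addN : left_inverse absub_zero absub_opp absub_add.
Proof. by move=> x; apply: val_inj; apply: mulVg. Qed.

HB.instance Definition _ := GRing.isZmodule.Build T
  absub_addA absub_addC absub_add0 absub_addN.

End AbelianSubgroup.

(** * The coinduced module and Shapiro's lemma *)

Section TranslationModule.
Variables (Q : groupType) (Z : zmodType).

(** For [Q = G / H] this is the module coinduced from [Z] with trivial action of [H]; the action is
    trivial because the extension is central over [H]. *)
Definition translation (q : Q) (u : Q -> Z) : Q -> Z := fun x => u (x * q)%g.

Fact translation1 u : translation 1%g u = u.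
Proof. by apply: functional_extensionality_dep => x;
  rewrite /translation mulg1. Qed.

Fact translationM q r u :
  translation (q * r)%g u = translation q (translation r u).
Proof. by apply: functional_extensionality_dep => x;
  rewrite /translation mulgA. Qed.

Fact translationB q : {morph translation q : u v / u - v}.
Proof. by []. Qed.

Definition translation_module : gmodule Q :=
  GModule translation1 translationM translationB.

End TranslationModule.

(* The cochain-level Shapiro isomorphism: [coset_part : G -> H] is equivariant
   for left multiplication by [H], so composing with it the homogeneous cocycle
   which measures the failure of the section [sigma] to be multiplicative gives
   a cocycle of [G] with values in the coinduced module. *)
Section CoinducedCocycle.
Local Open Scope group_scope.
Variables (E G : groupType).
Variables (H : finite_index_normal G) (sigma : G -> E) (S : {pred E}).
Hypotheses (gS : group_closed S)
  (cS : {in S &, commutative (fun x y : E => x * y)%g}).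
Hypothesis sigma_central : forall h x, h \in H -> x \in S ->
  x * sigma h = sigma h * x.
Hypothesis sigma_defect : forall g h, g \in H -> h \in H ->
  sigma g * sigma h * (sigma (g * h))^-1 \in S.

Local Notation Q := (quotient_group H).
Local Notation Z := (abelian_sub gS cS).

Definition coset_part (x : G) : G := x * (repr (\pi_Q x))^-1.

Lemma coset_partP x : coset_part x \in H.
Proof. by rewrite nsub_mulC; apply/piP; rewrite reprK. Qed.

Lemma coset_partM h x : h \in H -> coset_part (h * x) = h * coset_part x.
Proof.
move=> hH; rewrite /coset_part mulgA; congr (_ * (repr _)^-1).
by rewrite piM (pi_eq1 H h).2 // mul1g.
Qed.

Definition edge (x y : G) : E := sigma ((coset_part x)^-1 * coset_part y).

Lemma edge_in x y : (coset_part x)^-1 * coset_part y \in H.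
Proof. by rewrite nsubM ?nsubV ?coset_partP. Qed.

Lemma edgeM h x y : h \in H -> edge (h * x) (h * y) = edge x y.
Proof. by move=> hH; rewrite /edge !coset_partM // invgM -mulgA mulKg. Qed.

Fact triangle_subproof x y z : edge x y * edge y z * (edge x z)^-1 \in S.
Proof.
have := sigma_defect (edge_in x y) (edge_in y z).
by rewrite [in sigma (_ * _ * _)]mulgA mulgK.
Qed.

Definition triangle x y z : Z := exist (fun x =>
  x \in S) _ (triangle_subproof x y z).

Lemma triangleM h x y z : h \in H ->
  triangle (h * x) (h * y) (h * z) = triangle x y z.
Proof. by move=> hH; apply: val_inj; rewrite /= !edgeM. Qed.

(** Both sides telescope to [edge x y * edge y z * edge z t * (edge x t)^-1] once the central
    element [triangle y z t] is moved past [edge x y]. *)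
Lemma triangle_cocycle x y z t :
  (triangle x y z + triangle x z t = triangle y z t + triangle x y t)%R.
Proof.
apply: val_inj.
rewrite -[LHS]/(edge x y * edge y z * (edge x z)^-1 * (edge x z * edge z t *
  (edge x t)^-1)).
rewrite -[RHS]/(val (triangle y z t) * (edge x y * edge y t * (edge x t)^-1)).
rewrite !mulgA (sigma_central (edge_in x y) (valP (triangle y z t))).
by rewrite -/(edge x y) /= !mulgA !mulgVK.
Qed.

Definition coinduced := inflate (translation_module Q Z).

Definition coinduced_cocycle : cochain (restrict coinduced) 2 := fun g q =>
  triangle (repr q) (repr q * g ord0) (repr q * (g ord0 * g (lift ord0 ord0))).

(** Representatives of a coset differ by left multiplication by [H], under which [triangle] is
    invariant. The freedom in [z] serves the cocycle identity, where a translation replaces [z] by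
    [z * x]. *)
Lemma coinduced_cocycleE z x y :
  coinduced_cocycle (cons_fun x (fun=> y)) (\pi_Q z) =
  triangle z (z * x) (z * (x * y)).
Proof.
rewrite /coinduced_cocycle cons_fun0 cons_funS.
have hH : repr (\pi_Q z) * z^-1 \in H.
  by rewrite nsub_mulC; apply/piP; rewrite reprK.
by rewrite -(triangleM z (z * x) (z * (x * y)) hH) !mulgA !mulgVK.
Qed.

Lemma differential_coinduced : differential coinduced_cocycle = 0%R.
Proof.
apply: functional_extensionality_dep => g.
rewrite -(cons_fun_eta g) -(cons_fun_eta (fun k => g (lift ord0 k))).
rewrite (ord1_funE (fun k => g _)) differential2E.
set x := g _; set y := g _; set w := g _.
apply: functional_extensionality_dep => q; rewrite -[q]reprK; set z := repr q.
rewrite -[LHS]/(coinduced_cocycle (cons_fun y (fun=> w)) (\pi_Q z * \pi_Q x)%g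
  - coinduced_cocycle (cons_fun (x * y)%g (fun=> w)) (\pi_Q z)
  + coinduced_cocycle (cons_fun x (fun=> (y * w)%g)) (\pi_Q z)
  - coinduced_cocycle (cons_fun x (fun=> y)) (\pi_Q z))%R.
rewrite -piM !coinduced_cocycleE -!mulgA.
have tE := triangle_cocycle z (z * x) (z * (x * y)) (z * (x * (y * w))).
by rewrite (addrAC (triangle _ _ _)) -tE addrK subrr.
Qed.

End CoinducedCocycle.

Section FiniteKernel.
Local Open Scope group_scope.
Variables (E G : groupType) (p : {multiplicative E -> G}).
Hypothesis p_surj : forall g, exists e, p e = g.
Hypothesis finK : finite_set [set x | p x = 1].

(** The index is finite because conjugation permutes the finite kernel in finitely many ways. *)
Lemma kernel_centralizer : exists C : finite_index_normal E,
  forall x, x \in C <-> forall k, p k = 1 -> k ^ x = k.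
Proof.
have kerJ k x : p k = 1 -> p (k ^ x) = 1 by rewrite morphJ => ->;
  rewrite conj1g.
have [F [e e_inj]] := (finite_codeP _).1 finK.
have /finite_seqP[s sK] := finK.
have ks k : p k = 1 -> k \in s by move=> pk; have : [set x | p x = 1] k by [];
  rewrite sK.
have invC x : (forall k, p k = 1 -> k ^ x = k) -> forall k, p k = 1 ->
  k ^ x^-1 = k.
  by move=> xC k pk; rewrite -[in LHS](xC k pk) conjgK.
apply: fin_nsub_of => //.
- by move=> k _; rewrite conjg1.
- by move=> x y xC yC k pk; rewrite conjgM xC ?yC.
- move=> x y xC k pk; rewrite /conjg -/(conjg _ _) !conjgM xC ?conjgKV //.
  exact: kerJ.
(* Conjugation by the inverse is recorded because cosets are compared through [x^-1 * y]. *)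
exists {ffun seq_sub s -> F}, (fun x => [ffun k => e (ssval k ^ x^-1)]) =>
  x y xy k pk.
have /ffunP/(_ (SeqSub (ks k pk))) := xy; rewrite !ffunE /= => /e_inj kxy.
by rewrite conjgM kxy ?conjgKV //; apply: kerJ.
Qed.

(** A homomorphism on [U] that is a section up to conjugation by [t] has an image meeting the kernel
    trivially. The image has finite index, as the kernel is finite and [U] has finite index; [W] is
    its normal core. *)
Lemma kernel_complement (U : finite_index_normal G) (t : G) (rho : G -> E) :
  (forall m n, m \in U -> n \in U -> rho (m * n) = rho m * rho n) ->
  (forall m, m \in U -> p (rho m) = m ^ t) ->
  exists W : finite_index_normal E, forall x, x \in W -> p x = 1 -> x = 1.
Proof.
move=> rhoM p_rho.
have rho1 : rho 1 = 1.
  by apply: (mulgI (rho 1)); rewrite -rhoM ?nsub1 // !mulg1.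
have rhoV m : m \in U -> rho m^-1 = (rho m)^-1.
  by move=> mU; apply: (mulgI (rho m)); rewrite -rhoM ?nsubV // !mulgV rho1.
have gD : group_closed (fun x : E => `[< exists2 m, m \in U & rho m = x >]).
  apply: group_pred_closed; first by exists 1; rewrite ?nsub1.
    by move=> x y [m mU <-] [n nU <-]; exists (m * n); rewrite ?nsubM ?rhoM.
  by move=> x [m mU <-]; exists m^-1; rewrite ?nsubV ?rhoV.
have [s sP] := choice p_surj.
have [F [e e_inj]] := (finite_codeP _).1 finK.
have [F' [e' e'_inj]] := (finite_typeP _).1 (fin_index U).
(* Every [x] is written [w x * k * rho (m x)] with [k] in the kernel; the class of [p x] modulo [U]
   and the factor [k] fix the coset of the image. *)
pose w x := s (repr (\pi_(quotient_group U) (p x))).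
have wP x : (p (w x))^-1 * p x \in U by apply/piP; rewrite sP reprK.
have decomp x : exists m, m \in U /\ p ((w x)^-1 * x * (rho m)^-1) = 1.
  exists (((p (w x))^-1 * p x) ^ t^-1); split; first by rewrite nsubJE.
  by rewrite !gmulfM !morphV p_rho ?nsubJE // conjgKV mulgV.
have [m mP] := choice decomp.
have [|W WP] := fin_nsub_core (F := (F' * F)%type) (f := fun x =>
    (e' (\pi_(quotient_group U) (p x)), e ((w x)^-1 * x * (rho (m x))^-1))) gD.
  move=> x y [/e'_inj xy]; have wxy : w x = w y by rewrite /w xy.
  move=> /(e_inj _ _ (mP x).2 (mP y).2); rewrite wxy => kxy.
  apply/asboolP; exists ((m x)^-1 * m y).
    by rewrite nsubM ?nsubV // ?(mP _).1.
  rewrite rhoM ?nsubV ?rhoV ?(mP _).1 //.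
  have {}kxy : x * (rho (m x))^-1 = y * (rho (m y))^-1.
    by apply: (mulgI (w y)^-1); rewrite !mulgA.
  by apply: (mulgI x); rewrite mulgA kxy mulgVK mulVKg.
exists W => x /WP/(_ 1); rewrite conjg1 => /asboolP[n nU <-].
by rewrite p_rho // => /eqP; rewrite conjg_eq1 => /eqP->.
Qed.

Lemma residually_finite_of_complement (W : finite_index_normal E) :
  residually_finite G -> (forall x, x \in W -> p x = 1 -> x = 1) ->
  residually_finite E.
Proof.
move=> rfG Wp x x1; have [px|px] := pselect (p x = 1).
  by exists W; apply/negP => /Wp/(_ px).
have [N xN] := rfG _ px; have [N' N'P] := fin_nsub_preim p N.
by exists N'; apply/negP => /N'P; apply/negP.
Qed.

Lemma residually_finite_extension :
  residually_finite G -> comparison_onto G 2 -> residually_finite E.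
Proof.
move=> rfG onto; have [C CP] := kernel_centralizer.
have [H HP] := fin_nsub_image p_surj C.
(* A section over [H] with values in the centralizer; the value [1] outside [H] is arbitrary. *)
have sigma_ex h : exists e, h \in H -> e \in C /\ p e = h.
  have [/HP[e eC eh]|nH] := boolP (h \in H); first by exists e.
  by exists 1.
have [sigma sigmaP] := choice sigma_ex.
(* [S] is the centre of the kernel; it contains the factor set of [sigma] on [H]. *)
pose S : {pred E} := fun x => `[< p x = 1 /\ x \in C >].
have gS : group_closed S.
  apply: group_pred_closed => [|x y [px xC] [py yC]|x [px xC]].
  - by rewrite morph1 nsub1.
  - by rewrite gmulfM px py mulg1 nsubM.
  - by rewrite morphV px invg1 nsubV.
have cent x c : x \in S -> c \in C -> x * c = c * x.
  by move=> /asboolP[px _] /CP/(_ x px) xc; rewrite conjgC xc.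
have cS : {in S &, commutative (fun x y : E => x * y)}.
  by move=> x y xS /asboolP[_ yC]; apply: cent.
have sigma_central h x : h \in H -> x \in S -> x * sigma h = sigma h * x.
  by move=> /sigmaP[hC _] xS; apply: cent.
have sigma_defect g h : g \in H -> h \in H ->
    sigma g * sigma h * (sigma (g * h))^-1 \in S.
  move=> gH hH; have [[gC pg] [hC ph]] := (sigmaP g gH, sigmaP h hH).
  have [ghC pgh] := sigmaP _ (nsubM gH hH); apply/asboolP.
  by rewrite !nsubM ?nsubV // !gmulfM morphV pg ph pgh mulgV.
pose Z := abelian_sub gS cS.
have finZ : finite_set [set: Z].
  have [F [e e_inj]] := (finite_codeP _).1 finK; apply/finite_typeP.
  exists F, (fun z : Z => e (val z)) => z z' /e_inj zz'; apply: val_inj.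
  by apply: zz'; [case/asboolP: (valP z)|case/asboolP: (valP z')].
have finB : finite_set [set: translation_module (quotient_group H) Z].
  exact: finite_functions (fin_index H) finZ.
pose f := coinduced_cocycle gS cS sigma_defect.
have [c [Cc dc [b _ db]]] := onto (inflate_finite finB) f
  (differential_coinduced gS cS sigma_central sigma_defect).
have [V cV] := (continuous_cochainP c).1 Cc.
have [U UP] := fin_nsub_meet V H.
(* The representative [t] of the trivial coset may differ from [1], which is why [tau] conjugates by
   [t^-1]. *)
pose t := repr (\pi_(quotient_group H) 1).
pose q1 : quotient_group H := \pi_(quotient_group H) (1%g : G).
(* On [U] the cocycle [c] takes a constant value, equal to [c1] at [q1]. Under a trivial action a
   constant 2-cocycle is the coboundary of the same constant, whence the summand [c1] in [a]. *)
pose c1 : Z := c (fun=> 1) q1.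
pose a m : Z := (c1 + (b (fun=> m) : quotient_group H -> Z) q1)%R.
pose tau m := sigma (m ^ t^-1).
have tau_a m n : m \in U -> n \in U ->
    tau m * tau n * (tau (m * n))^-1 = val (a m) * val (a n) * (val (a (m *
      n)))^-1.
  move=> /UP[mV mH] /UP[nV nH].
  have part x : x \in H -> coset_part H (1 * x) = x * t^-1.
    by move=> xH; rewrite mul1g -[x in LHS]mulg1 coset_partM // /coset_part
      mul1g.
  have part1 : coset_part H 1 = t^-1 by rewrite /coset_part mul1g.
  have tri : val (triangle gS cS sigma_defect 1 (1 * m) (1 * (m * n))) =
      tau m * tau n * (tau (m * n))^-1.
    rewrite /= /edge !part ?nsubM // part1 invgM !mulgA mulgVK.
    by rewrite /tau /conjg !mulgA.
  rewrite -tri -coinduced_cocycleE.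
  have cmn : c (fun k => completion_map (cons_fun m (fun=> n) k)) = c (fun=> 1).
    apply: cV => i; apply/(pi_eq1 V); case: (unliftP ord0 i) => [j|] ->.
      by rewrite cons_funS.
    by rewrite cons_fun0.
  have := congr1 (fun u => (u (cons_fun m (fun=> n)) : quotient_group H ->
    Z) q1) db.
  rewrite differential1E.
  rewrite -[LHS]/((b (fun=> n) : quotient_group H ->
    Z) (q1 * \pi_(quotient_group H) m)%g
    - (b (fun=> (m * n)%g) : quotient_group H -> Z) q1
    + (b (fun=> m) : quotient_group H -> Z) q1)%R.
  rewrite -[RHS]/(f (cons_fun m (fun=> n)) q1
    - (c (fun k => completion_map (cons_fun m (fun=> n) k)) :
      quotient_group H -> Z) q1)%R.
  (* Evaluation at [q1] undoes the coinduction: [m] lies in [H], so translation by it fixes [q1]. *)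
  rewrite cmn ((pi_eq1 H m).2 mH) mulg1 -/c1 => fE.
  rewrite -[LHS]/(val (f (cons_fun m (fun=> n)) q1)).
  rewrite -[RHS]/(val (a m + a n - a (m * n)%g)%R); congr val.
  rewrite -(subrK c1 (f _ _)) -fE addrC /a opprD addrACA (addrC c1 (_ q1))
    addrK.
  by rewrite [RHS]addrC -!addrA.
(* The factor set of [tau] on [U] is the coboundary of [a], so dividing by [a] makes the section
   multiplicative. *)
pose rho m := (val (a m))^-1 * tau m.
have tauC m : m \in U -> tau m \in C /\ p (tau m) = m ^ t^-1.
  by move=> /UP[_ mH]; apply: sigmaP; rewrite nsubJE.
have [||W WP] := @kernel_complement U t^-1 rho.
- move=> m n mU nU; rewrite /rho.
  have [mC _] := tauC m mU.
  have aC : (val (a n))^-1 * tau m = tau m * (val (a n))^-1.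
    exact: cent (valP (- a n)%R) mC.
  have tau_mn : tau m * tau n = val (a m) * val (a n) * (val (a (m * n)))^-1 *
    tau (m * n).
    by rewrite -tau_a // mulgVK.
  rewrite -!mulgA (mulgA (tau m)) -aC -(mulgA _ (tau m)) tau_mn.
  have -> : val (a m) * val (a n) = val (a n) * val (a m).
    exact: cS (valP (a m)) (valP (a n)).
  move: (val (a m)) (val (a n)) (val (a (m * n))) => x y z.
  by rewrite -!mulgA !mulKg.
- move=> m mU; have [_ pm] := tauC m mU.
  have /asboolP[pa _] := valP (a m).
  by rewrite /rho gmulfM morphV pa invg1 mul1g.
exact: residually_finite_of_complement rfG WP.
Qed.

End FiniteKernel.

(** * Reduction from finitely generated to finite kernels *)

Section FinitelyGeneratedKernel.
Local Open Scope group_scope.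

Definition multiplicative_of (H K : groupType) (u : H -> K)
    (uM : {morph u : x y / x * y}) : {multiplicative H -> K} :=
  HB.pack_for {multiplicative H -> K} u (isMultiplicative.Build H K u uM).

Variables (N E G : groupType).
Variables (i : {multiplicative N -> E}) (p : {multiplicative E -> G}).
Hypothesis ext : group_extension i p.

Lemma ext_conj e : exists v : {multiplicative N ->
  N}, forall x, i (v x) = i x ^ e.
Proof.
have i_inj := ext_injective ext.
have conj_ex x : exists y, i y = i x ^ e.
  apply/(ext_exact ext); rewrite morphJ.
  by rewrite ((ext_exact ext (i x)).2 _) ?conj1g //; exists x.
have [v vP] := choice conj_ex.
have vM : {morph v : x y / x * y}.
  by move=> x y; apply: i_inj; rewrite gmulfM !vP gmulfM conjMg.
by exists (multiplicative_of vM).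
Qed.

(* Dividing by a finite-index characteristic subgroup of [N] which avoids a
   given element reduces to the case of a finite kernel. *)
Lemma residually_finite_fg_extension :
  residually_finite G -> comparison_onto G 2 ->
  finitely_generated N -> residually_finite N -> residually_finite E.
Proof.
move=> rfG onto fgN rfN e e1; have i_inj := ext_injective ext.
have [pe|pe] := pselect (p e = 1); last first.
  have [M eM] := rfG _ pe; have [M' M'P] := fin_nsub_preim p M.
  by exists M'; apply/negP => /M'P; apply/negP.
have [n ne] := (ext_exact ext e).1 pe.
have n1 : n <> 1 by move=> n1; apply: e1; rewrite -ne n1 morph1.
have [M nM] := rfN _ n1.
have [W WP] := fg_hom_kernel fgN (fin_index M).
have p_i x : p (i x) = 1 by apply/(ext_exact ext); exists x.
have [L LP] : exists L : normal_subgroup E, forall y, y \in L <-> exists2 x,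
  x \in W & i x = y.
  apply: normal_subgroup_of.
  - by exists 1; rewrite ?nsub1 ?morph1.
  - by move=> y z [x xW <-] [x' x'W <-]; exists (x * x');
    rewrite ?nsubM ?gmulfM.
  - by move=> y [x xW <-]; exists x^-1; rewrite ?nsubV ?morphV.
  (* Composing [u] with conjugation by [z] gives another homomorphism from [N] to [N / M], which
     also kills [x]. *)
  move=> y z [x /WP xW <-]; have [v vP] := ext_conj z.
  exists (v x) => //; apply/WP => u.
  have uvM : {morph u \o v : x y / x * y} by move=> x1 x2; rewrite /= !gmulfM.
  exact: xW (multiplicative_of uvM).
pose E' := quotient_group L.
have pL x y : \pi_E' x = \pi_E' y -> p x = p y.
  move=> /piP/LP[z _ iz]; apply: (mulgI (p x)^-1).
  by rewrite mulVg -morphV -gmulfM -iz p_i.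
pose p' (q : E') := p (repr q).
have p'E x : p' (\pi_E' x) = p x by apply: pL; rewrite reprK.
have p'M : {morph p' : q r / q * r}.
  by move=> q r; rewrite -[q]reprK -[r]reprK -piM !p'E gmulfM.
have rfE' : residually_finite E'.
  apply: (@residually_finite_extension _ _ (multiplicative_of p'M)) => //.
    by move=> g; have [x <-] := ext_surjective ext g; exists (\pi_E' x);
      apply: p'E.
  (* The kernel of [p'] is the image of [N], in which [W] becomes trivial, so it is finite. *)
  have [F [f fP]] := finite_index_code W.
  have lift_ex (q : E') : exists x, p' q = 1 -> i x = repr q.
    have [/(ext_exact ext)[x xq]|nq] := pselect (p (repr q) = 1);
      first by exists x.
    by exists 1.
  have [l lP] := choice lift_ex.
  apply/finite_codeP; exists F, (f \o l) => q r pq pr /fP lqr.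
  rewrite -[q]reprK -[r]reprK; apply/piP/LP; exists ((l q)^-1 * l r) => //.
  by rewrite gmulfM morphV (lP q pq) (lP r pr).
(* The projection of [N] to [N / M] is among the homomorphisms that kill [W], so [W] lies in [M] and
   misses [n]. *)
have pi_e : \pi_E' e <> 1.
  move=> /pi_eq1/LP[x xW]; rewrite -ne => /i_inj xn; move: nM; rewrite -xn.
  move=> /negP; apply; apply/pi_eq1.
  exact: (WP x).1 xW (multiplicative_of (@piM _ M)).
have [M' eM'] := rfE' _ pi_e.
have [M'' M''P] := fin_nsub_preim (multiplicative_of (@piM _ L)) M'.
by exists M''; apply/negP => /M''P; apply/negP.
Qed.

End FinitelyGeneratedKernel.

(** * Finite groups, and the implications between the three conditions *)

Section FiniteGroups.
Local Open Scope group_scope.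
Variable F : groupType.
Hypothesis finF : finite_set [set: F].

Lemma finite_finitely_generated : finitely_generated F.
Proof.
have /finite_seqP[s sF] := finF; exists s => S _ sS x; apply: sS.
by have : [set: F] x by []; rewrite sF.
Qed.

Lemma finite_residually_finite : residually_finite F.
Proof.
have [e [c c_inj]] := (finite_typeP _).1 finF.
have [V VP] : exists V : finite_index_normal F, forall x, x \in V <-> x = 1.
  apply: fin_nsub_of => [//|x y -> ->|x ->|x y ->|].
  - by rewrite mulg1.
  - by rewrite invg1.
  - by rewrite conj1g.
  by exists e, c => x y /c_inj ->; rewrite mulVg.
by move=> x x1; exists V; apply/negP => /VP.
Qed.

End FiniteGroups.

Lemma class_A2_comparison_onto (G : groupType) :
  class_A 2 G -> comparison_onto G 2.
Proof.
move=> GA A f; apply: (comparison_surjectiveP A 2).1 => y.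
have [h hK1 hK2] := (GA A).1 2%N isT.
by exists (h y).
Qed.

Lemma class_A2_of_comparison_onto (G : groupType) :
  comparison_onto G 2 -> class_A 2 G.
Proof.
move=> onto2 A; have onto0 := @comparison_onto0 G;
  have onto1 := @comparison_onto1 G.
have into0 := @comparison_into0 G; have into1 := @comparison_into1 G.
have into2 := comparison_into_step onto1 into1.
have into3 := comparison_into_step onto2 into2.
have inj n : comparison_into G n -> injective (@comparison G A n).
  by move=> into; apply: comparison_injective; apply: into.
have bij n : comparison_into G n -> comparison_onto G n ->
    bijective (@comparison G A n).
  move=> /inj into onto; apply: inj_surj_bijective into _.
  by apply/comparison_surjectiveP; apply: onto.
split; last exact: inj.
by move=> [|[|[|n]]] // _; apply: bij.
Qed.

(** [G] is an extension of itself by the trivial group, realized as the quotient of [G] by the whole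
    of [G]. *)
Lemma residually_finite_of_extensions (G : groupType) :
  (forall (F E : groupType)
     (i : {multiplicative F -> E}) (p : {multiplicative E -> G}),
     group_extension i p -> finite_set [set: F] -> residually_finite E) ->
  residually_finite G.
Proof.
have [V VP] := fin_nsub_whole G.
have V1 (q : quotient_group V) : q = 1%g by rewrite -[q]reprK; apply/pi_eq1.
have iM : {morph (fun _ : quotient_group V =>
  1%g : G) : x y / (x * y)%g >-> (x * y)%g}.
  by move=> x y; rewrite mulg1.
have idM : {morph (@id G) : x y / (x * y)%g} by [].
move=> /(_ (quotient_group V) G (multiplicative_of iM) (multiplicative_of idM)).
apply; last exact: fin_index.
split=> [q r _|g|g]; first by rewrite (V1 q) (V1 r).
  by exists g.
split=> [/= g1|[q <-]] //; by exists 1%g; rewrite /= g1.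
Qed.

Theorem theorem2p10 (G : groupType) :
  [<-> residually_finite G /\ class_A 2 G;
       forall (N E : groupType)
         (i : {multiplicative N -> E}) (p : {multiplicative E -> G}),
         group_extension i p -> finitely_generated N -> residually_finite N ->
         residually_finite E;
       forall (F E : groupType)
         (i : {multiplicative F -> E}) (p : {multiplicative E -> G}),
         group_extension i p -> finite_set [set: F] -> residually_finite E].
Proof.
tfae=> [[rfG /class_A2_comparison_onto onto2] N E i p ext|ext_rf F E i p ext
  finF|ext_rf].
- exact: residually_finite_fg_extension ext rfG onto2.
- apply: ext_rf ext _ _; first exact: finite_finitely_generated.
  exact: finite_residually_finite.
split; first exact: residually_finite_of_extensions ext_rf.
exact/class_A2_of_comparison_onto/comparison_onto2.
Qed.
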